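(* Let $\alpha,\lambda>0$ and, for all sufficiently large $n$, let $p=p_n=1-\frac{\lambda}{n^{\alpha}}$. Let $X_n=X_n(p_n)$ be the number of correct guesses under the optimal strategy in the complete feedback game after one asymmetric single-shelf shuffle of $n$ cards with parameter $p_n$. Then, as $n\to\infty$: (1) When $\alpha>1$, $X_n/n$ converges to $1$ in probability. (2) When $\alpha=1$ (i.e. $p_n=1-\lambda/n$), the number of incorrect guesses $D_n:=n-X_n$ converges in distribution to a $\mathrm{Poisson}(\lambda)$ random variable. (3) When $\alpha\in(0,1)$, $(X_n-\mathbb{E}(X_n))/\sqrt{\mathrm{Var}(X_n)}$ converges in distribution to a standard normal random variable.
   Context: Asymmetric single-shelf shuffle with parameter $p\in(0,1)$: start with an ordered deck of $n$ cards labelled $1,\dots,n$ (card $1$ on top). Cards are drawn one at a time from the bottom of the deck (card $n$ first, card $1$ last) and placed in a pile; independently, each drawn card is placed at the top of the pile with probability $p$ and at the bottom with probability $1-p$. Equivalently, let $\varepsilon_1,\dots,\varepsilon_{n-1}$ be independent Bernoulli$(p)$ ($\varepsilon_j=1$ iff card $j$ is placed at the top); the shuffled deck read from the top consists of the cards $j\le n-1$ with $\varepsilon_j=1$ in increasing order, then card $n$, then the cards with $\varepsilon_j=0$ in decreasing order. Complete feedback game: the player guesses the cards of the shuffled deck sequentially from the top; after each guess the card is shown and removed. Let $\nu=1$ if $p\ge\frac12$ and $\nu=\lfloor \log p/\log(1-p)\rfloor+1$ if $0<p<\frac12$. Optimal strategy used: let $j$ be the label of the last card shown ($j=0$ before the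 first guess). As long as neither card $n$ nor card $n-1$ has been shown: if $p\ge\frac12$, guess $j+1$; if $p<\frac12$, guess $n$ when $n-j\le\nu$ and guess $j+1$ when $n-j>\nu$. Once card $n$ or $n-1$ has been shown, guess the remaining cards in decreasing order. $X_n(p)$ denotes the number of correct guesses under this strategy. *)

(* Defs.v *)
From HB Require Import structures.
From mathcomp Require Import all_boot all_order all_algebra.
From mathcomp Require Import all_classical all_reals all_analysis.
From mathcomp Require Import measurable_realfun.

Set Implicit Arguments.
Unset Strict Implicit.
Unset Printing Implicit Defensive.

Import Order.TTheory GRing.Theory Num.Theory.
Import numFieldNormedType.Exports.

Local Open Scope classical_set_scope.
Local Open Scope ring_scope.

(* [e j] says whether card [j] is placed at the top of the pile.  [foldr] meets
   the cards [n, n.-1, ..., 1] in this order; [e n] is irrelevant, as card [n]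
   is placed on an empty pile.  The head of the list is the top of the deck. *)
Definition shuffled_deck (n : nat) (e : nat -> bool) : seq nat :=
  foldr (fun j pile => if e j then j :: pile else rcons pile j) [::] (iota 1 n).

(* A guess given the cards already shown, the most recent one first. *)
Definition strategy := seq nat -> nat.

Fixpoint score (s : strategy) (shown deck : seq nat) : nat :=
  if deck is c :: deck' then ((s shown == c) + score s (c :: shown) deck')%N
  else 0%N.

Definition nu (R : realType) (p : R) : int :=
  if 2^-1 <= p then 1%Z else Num.floor (ln p / ln (1 - p)) + 1.

(* The labels are [1, ..., n], so [j = 0] before the first guess. *)
Definition optimal_strategy (R : realType) (n : nat) (p : R) : strategy :=
  fun shown =>
    if (n \in shown) || (n.-1 \in shown) then
      (\max_(c <- iota 1 n | c \notin shown) c)%N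
    else let j := head 0%N shown in
      if 2^-1 <= p then j.+1
      else if (n%:Z - j%:Z <= nu p)%R then n else j.+1.

Definition correct_guesses (R : realType) (n : nat) (p : R) (e : nat -> bool)
    : nat :=
  score (optimal_strategy n p) [::] (shuffled_deck n e).

Lemma eq_shuffled_deck (n : nat) (e e' : nat -> bool) :
  (forall j, (j <= n)%N -> e j = e' j) ->
  shuffled_deck n e = shuffled_deck n e'.
Proof.
move=> ee'; rewrite /shuffled_deck.
have : {in iota 1 n, e =1 e'}.
  by move=> j; rewrite mem_iota add1n ltnS => /andP[_ /ee'].
elim: (iota 1 n) => //= j s IH h.
rewrite h ?mem_head// IH// => i si; apply: h.
by rewrite inE si orbT.
Qed.

Section num_correct.
Context d (T : measurableType d) (R : realType) (P : probability T R).

Definition num_correct (n : nat) (p : R) (eps : nat -> {RV P >-> bool}) : T -> R :=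
  fun w => (correct_guesses n p (fun j => eps j w))%:R.

Variables (n : nat) (p : R) (eps : nat -> {RV P >-> bool}).

Lemma measurable_num_correct :
  measurable_fun setT (num_correct n p eps).
Proof.
pose f w : {ffun 'I_n.+1 -> bool} := [ffun j : 'I_n.+1 => eps j w].
pose g (b : {ffun 'I_n.+1 -> bool}) : R :=
  (correct_guesses n p (fun j => b (inord j)))%:R.
have fg : num_correct n p eps = g \o f.
  apply/funext => w; rewrite /num_correct /g /= /correct_guesses; congr (score _ _ _)%:R.
  by apply: eq_shuffled_deck => j jn; rewrite ffunE inordK.
move=> _ A _; rewrite setTI fg comp_preimage.
rewrite (_ : f @^-1` _ = \bigcup_(b in g @^-1` A) f @^-1` [set b]); last first.
  apply/seteqP; split => [w Aw|w [b Ab fwb]]; first by exists (f w).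
  by rewrite /preimage /= fwb.
apply: fin_bigcup_measurable; first exact: finite_finset.
move=> b _.
rewrite (_ : _ @^-1` _ = \bigcap_(i in [set: 'I_n.+1]) eps i @^-1` [set b i]).
  apply: fin_bigcap_measurable; first exact: finite_finset.
  by move=> i _; rewrite -[X in measurable X]setTI; exact: measurable_funPT.
apply/seteqP; split => [w /= <- i _ /=|w h]; first by rewrite ffunE.
by apply/ffunP => i; rewrite ffunE; exact: h.
Qed.

HB.instance Definition _ :=
  isMeasurableFun.Build _ _ _ _ (num_correct n p eps) measurable_num_correct.

End num_correct.

Definition mutually_independent d d' (T : measurableType d)
    (T' : measurableType d') (R : realType) (P : probability T R)
    (I : finType) (X : I -> {RV P >-> T'}) : Prop :=
  forall (J : {set I}) (B : I -> set T'),
    (forall i, measurable (B i)) ->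
    P (\bigcap_(i in [set i | i \in J]) X i @^-1` B i) =
    (\prod_(i in J) P (X i @^-1` B i))%E.

(* Only the coins of the cards [1, ..., n.-1] are constrained. *)
Definition shuffle_coins d (T : measurableType d) (R : realType)
    (P : probability T R) (n : nat) (p : R) (eps : nat -> {RV P >-> bool})
    : Prop :=
  (forall i : 'I_n.-1,
     distribution P (eps i.+1) = bernoulli_prob p :> (set bool -> \bar R)) /\
  mutually_independent (fun i : 'I_n.-1 => eps i.+1).

Definition cvg_in_probability (R : realType) (d : nat -> measure_display)
    (T : forall n, measurableType (d n)) (P : forall n, probability (T n) R)
    (X : forall n, {RV (P n) >-> R}) (c : R) : Prop :=
  forall e : R, 0 < e ->
    P n [set w | e < `|X n w - c|] @[n --> \oo] --> 0%E.

Arguments cvg_in_probability {R d T} P X c.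

Definition cvg_in_distribution (R : realType) (d : nat -> measure_display)
    (T : forall n, measurableType (d n)) (P : forall n, probability (T n) R)
    (X : forall n, {RV (P n) >-> R}) (d' : measure_display)
    (T' : measurableType d') (Q : probability T' R) (Y : {RV Q >-> R}) : Prop :=
  forall x : R, {for x, continuous (cdf Y)} ->
    cdf (X n) x @[n --> \oo] --> cdf Y x.

Arguments cvg_in_distribution {R d T} P X {d' T' Q} Y.

(* The second argument of the library's [poisson_prob] is not used. *)
Definition poisson_law (R : realType) (rate : R) : probability nat R :=
  poisson_prob rate 0%N.

Definition nat_embedding (R : realType) (k : nat) : R := k%:R.

HB.instance Definition _ (R : realType) :=
  isMeasurableFun.Build _ _ nat R (@nat_embedding R) (fun _ _ _ => I).

Definition poisson_RV (R : realType) (rate : R) : {RV (poisson_law rate) >-> R} :=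
  @nat_embedding R.

(* [normal_prob m s] has standard deviation [s], so variance [s ^+ 2]. *)
Definition std_normal_law (R : realType) : probability (measurableTypeR R) R :=
  normal_prob 0 1.

Definition real_id (R : realType) : measurableTypeR R -> R := idfun.

HB.instance Definition _ (R : realType) :=
  isMeasurableFun.Build _ _ (measurableTypeR R) R (@real_id R)
    (@measurable_id _ _ setT).

Definition std_normal_RV (R : realType) : {RV (std_normal_law R) >-> R} :=
  @real_id R.

(* Main.v *)
Require Import Defs.
From HB Require Import structures.
From mathcomp Require Import all_boot all_order all_algebra.
From mathcomp Require Import all_classical all_reals all_analysis.
From mathcomp Require Import measurable_realfun ring lra zify.

(** Write [q = 1 - p], and call a card [j < n] a one or a zero according to
    whether it is placed at the top or at the bottom of the pile.  As [q] tends
    to [0], only the case [p >= 1/2] matters, in which the player keeps guessing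
    the successor of the last card shown.  Each maximal run of zeros costs one
    guess, since the card shown in its place is the one that follows the run or,
    for a run that ends at [n.-1], the card [n].  Once [n] or [n.-1] has
    been shown, the remaining cards come in decreasing order and nothing is lost
    any more.  Hence ([correct_guesses_zero_runs], [zero_runsD])

      n - X = number of runs of zeros = Z - A,

    where [Z] is the number of zeros, a binomial variable with mean about [n q],
    and [A] is the number of pairs of consecutive zeros.  The correction [A] is
    of lower order, since its mean is at most [n q ^ 2] and its variance at most
    [3 n q ^ 2] ([coin_mean_adjacent_zeros], [coin_var_adjacent_zeros]).

    - If [n - X] is divided by [n], Markov's inequality suffices, because
      [Z / n] has mean at most [q].
    - If [n q] tends to [lambda], then [A] vanishes with high probability and
      [Z] tends to a Poisson variable ([cvg_binomial_poisson]).
    - If [n q] tends to infinity, let [N] be the number of ones.  Up to a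
      constant, [X = N + A], and the variance of [A] is negligible compared with
      that of [N]; so the normalizations of [X] and of [N] are close in mean
      square ([coin_mean_normalized_perturbation]), and the central limit
      theorem for [N] is enough ([binomial_clt_bound]).

    Both limit laws come from one identity, the size bias of a binomial variable
    ([coin_mean_size_bias]): the mean of [N F(N)] over [m.+1] coins is
    [(m.+1) p] times the mean of [F(N + 1)] over [m] coins.  With the indicator
    of a point for [F] it computes the law of [Z] by induction.  For the
    normalized variable [W = (N - E N) / sigma] it reads

      E (W f(W)) = sigma E (f(V + 1 / sigma) - f(V)),

    with [V] the contribution of all coins but one, and the right-hand side is
    close to [E f'(W)] by the mean value theorem.  Taking for [f] a solution of
    Stein's equation [f'(w) - w f(w) = h(w) - mean of h], with the mean under
    the normal law ([stein_solution]), bounds the distance between [E h(W)] and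
    that mean, for every Lipschitz [h] with values in the unit interval.

    As the game only depends on finitely many coins, all means are computed by
    [coin_mean], which peels off one coin at a time. *)

Set Implicit Arguments.
Unset Strict Implicit.
Unset Printing Implicit Defensive.

Import Order.TTheory GRing.Theory Num.Theory.
Import numFieldNormedType.Exports.

Local Open Scope classical_set_scope.
Local Open Scope ring_scope.

(** * Wrong guesses are runs of cards placed at the bottom *)

Section score.
Local Open Scope nat_scope.
Variables (R : realType) (p : R) (n : nat).
Hypothesis p_ge : (2^-1 <= p)%R.
Local Notation play := (score (optimal_strategy n p)).

(** A run of zeros is counted at its last element; the default [true] of [head]
    closes a run that reaches the end of the sequence. *)
Fixpoint zero_runs (s : seq bool) : nat :=
  if s is b :: s' then (~~ b && head true s') + zero_runs s' else 0.

Lemma foldr_pile (e : nat -> bool) (pile s : seq nat) :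
  foldr (fun j pile => if e j then j :: pile else rcons pile j) pile s =
  [seq j <- s | e j] ++ pile ++ rev [seq j <- s | ~~ e j].
Proof.
elim: s => [|j s IH] /=; first by rewrite cats0.
by rewrite IH; case: (e j) => //=; rewrite rev_cons !rcons_cat.
Qed.

Lemma shuffled_deckE (m : nat) (e : nat -> bool) :
  shuffled_deck m.+1 e =
  [seq j <- iota 1 m | e j] ++ m.+1 :: rev [seq j <- iota 1 m | ~~ e j].
Proof.
rewrite /shuffled_deck -[X in iota 1 X]addn1 iotaD/= add1n cats1 foldr_rcons.
by rewrite (_ : (if e m.+1 then _ else _) = [:: m.+1]) ?foldr_pile//; case: ifP.
Qed.

Lemma perm_shuffled_deck (m : nat) (e : nat -> bool) :
  perm_eq (shuffled_deck m.+1 e) (iota 1 m.+1).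
Proof.
rewrite shuffled_deckE -[X in perm_eq _ (iota 1 X)]addn1 iotaD/= add1n cats1.
rewrite perm_sym perm_rcons perm_sym -(cat1s m.+1) perm_catCA/= perm_cons.
by rewrite perm_sym -(perm_filterC e) perm_cat2l perm_sym perm_rev.
Qed.

(** The largest card not yet shown is then always the head of the deck. *)
Lemma play_decreasing (shown deck : seq nat) :
  perm_eq (shown ++ deck) (iota 1 n) -> sorted gtn deck ->
  (n \in shown) || (n.-1 \in shown) -> play shown deck = size deck.
Proof.
elim: deck shown => [//|c deck IH] shown shown_deck deck_sorted seen /=.
rewrite [X in X == c](_ : _ = c).
  rewrite eqxx add1n IH//; first by rewrite cat_cons -cat1s perm_catCA.
  - exact: path_sorted deck_sorted.
  - by case/orP: seen => h; rewrite !inE h !orbT.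
rewrite /optimal_strategy seen; apply/eqP; rewrite eqn_leq; apply/andP; split.
  apply/bigmax_leqP_seq => i; rewrite -(perm_mem shown_deck) mem_cat.
  move=> /orP[->//|]; rewrite inE => /orP[/eqP->//|ideck] _.
  have := deck_sorted; rewrite /= (path_sortedE (rev_trans ltn_trans)).
  by move=> /andP[/allP/(_ _ ideck)/ltnW].
apply: leq_bigmax_seq.
  by rewrite -(perm_mem shown_deck) mem_cat mem_head orbT.
have := perm_uniq shown_deck; rewrite iota_uniq cat_uniq /= => /and3P[_].
by rewrite negb_or => /andP[].
Qed.

(** The induction runs over the cards [k.+1, ..., n.-1] still undecided.  If the
    last card shown is not [k], then [k] is a zero whose run is still open: it is
    charged only when the next one, or card [n], is shown.  The leading [false]
    stands for this open run. *)
Lemma play_increasing (e : nat -> bool) (l k : nat) (shown low : seq nat) :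
  k + l = n.-1 -> 0 < n.-1 ->
  let deck := [seq j <- iota k.+1 l | e j] ++ n :: low in
  perm_eq (shown ++ deck) (iota 1 n) -> sorted gtn (n :: low) ->
  all (geq k) shown -> n.-1 \notin shown ->
  play shown deck +
    zero_runs (nseq (head 0 shown != k) false ++ map e (iota k.+1 l)) =
  size deck.
Proof.
move=> kl n1; have n0 : 0 < n by case: (n) n1.
have nn1 : n = n.-1.+1 by rewrite prednK.
have strat (j : nat) (s : seq nat) : j <= n.-1 -> all (geq j) s ->
    n.-1 \notin s -> optimal_strategy n p s = (head 0 s).+1.
  move=> jn le_j n1s; rewrite /optimal_strategy p_ge (negbTE n1s) orbF.
  case: ifP => // ns; have := leq_trans (allP le_j _ ns) jn.
  by rewrite {1}nn1 ltnn.
elim: l k shown kl => [|l IH] k shown kl deck perm low_s le_k n1s.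
  have ltk : head 0 shown < n.-1.
    case: shown le_k n1s {perm} => //= a shown /andP[+ _].
    by rewrite inE negb_or eq_sym -kl addn0 ltn_neqAle => -> /andP[->].
  rewrite [deck]/= -[X in _ != X]addn0 kl (ltn_eqF ltk) /= addn0.
  rewrite (strat k)// -?kl ?leq_addr// [X in _ == X]nn1 eqSS (ltn_eqF ltk).
  rewrite add0n addn1; congr _.+1; apply: play_decreasing; last by rewrite mem_head.
    by rewrite cat_cons -cat1s perm_catCA.
  exact: path_sorted low_s.
have kS : k.+1 + l = n.-1 by rewrite addSnnS.
have le_kS : all (geq k.+1) shown by apply: sub_all le_k => i /= /leqW.
have head_k : head 0 shown <= k by case: (shown) le_k => //= a s /andP[].
move: perm; rewrite /deck [iota _ _]/= [map _ _]/= [[seq _ <- _ | _]]/=.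
case: ifP => ek perm; last first.
  rewrite -(IH _ _ kS perm) // (ltn_eqF (_ : head 0 shown < k.+1))//.
  by case: (_ == k).
have perm' : perm_eq ((k.+1 :: shown) ++ [seq j <- iota k.+2 l | e j] ++ n :: low)
    (iota 1 n) by rewrite cat_cons -cat1s perm_catCA.
rewrite [play _ _]/= (strat k)// -?kl ?leq_addr// eqSS.
rewrite [RHS]/= -[RHS]add1n.
have -> : zero_runs (nseq (head 0 shown != k) false ++
      true :: [seq e i | i <- iota k.+2 l]) =
    (head 0 shown != k) + zero_runs [seq e i | i <- iota k.+2 l].
  by case: (_ == k).
rewrite addnACA; congr (_ + _); first by case: (_ == k).
have [l0|l0] := posnP l.
  move: perm'; rewrite l0 [iota _ 0]/= cat0s addn0 => perm'.
  apply: play_decreasing => //.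
  by rewrite -kS l0 addn0 mem_head orbT.
rewrite -(IH _ (k.+1 :: shown) kS perm')//=.
- by rewrite eqxx.
- by rewrite leqnn.
- by rewrite inE negb_or n1s andbT -kS gtn_eqF// -addn1 leq_add2l.
Qed.

Theorem correct_guesses_zero_runs (e : nat -> bool) : 0 < n.-1 ->
  correct_guesses n p e + zero_runs [seq e j | j <- iota 1 n.-1] = n.
Proof.
move=> n1; have nn1 : n.-1.+1 = n by rewrite prednK//; case: (n) n1.
have := perm_shuffled_deck n.-1 e; have := shuffled_deckE n.-1 e.
rewrite nn1 => deckE perm_deck; rewrite /correct_guesses.
have perm' := perm_deck; rewrite deckE in perm'.
have := @play_increasing e n.-1 0 [::] _ (add0n _) n1 perm'.
rewrite [nseq _ _]/= cat0s -deckE => ->//.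
  by rewrite (perm_size perm_deck) size_iota.
rewrite /= (path_sortedE (rev_trans ltn_trans)); apply/andP; split.
  apply/allP => j; rewrite mem_rev mem_filter mem_iota add1n nn1 => /andP[_].
  by case/andP.
by rewrite rev_sorted sorted_filter ?iota_ltn_sorted//; exact: ltn_trans.
Qed.
End score.

(** * Means over independent coins *)

Section coin_mean.
Context {R : realType}.
Variable p : R.
Implicit Types (m : nat) (g : seq bool -> R) (b : bool).
Local Notation pr := (bernoulli_pmf p).

(** The mean of [g] over [m] independent coins that show [true] with probability
    [p]. *)
Fixpoint coin_mean m g : R :=
  if m is m'.+1 then
    p * coin_mean m' (g \o cons true) + (1 - p) * coin_mean m' (g \o cons false)
  else g [::].

Local Notation E := coin_mean.

Lemma coin_meanS b m g :
  E m.+1 g = pr b * E m (g \o cons b) + pr (~~ b) * E m (g \o cons (~~ b)).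
Proof. by case: b => //=; rewrite addrC. Qed.

Lemma sum_bernoulli_pmf b : pr b + pr (~~ b) = 1.
Proof. by case: b; rewrite /= ?subrK// addrC subrK. Qed.

Lemma eq_coin_mean m g g' :
  (forall s, size s = m -> g s = g' s) -> E m g = E m g'.
Proof.
elim: m g g' => [|m IH] g g' gg' /=; first exact: gg'.
by congr (_ * _ + _ * _); apply: IH => s sm /=; apply: gg'; rewrite /= sm.
Qed.

Lemma coin_meanD m g g' : E m (fun s => g s + g' s) = E m g + E m g'.
Proof.
elim: m g g' => [//|m IH] g g' /=.
rewrite (IH (g \o cons true)) (IH (g \o cons false)).
by rewrite !mulrDr addrACA.
Qed.

Lemma coin_meanZ m a g : E m (fun s => a * g s) = a * E m g.
Proof.
elim: m g => [//|m IH] g /=.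
by rewrite (IH (g \o cons true)) (IH (g \o cons false)) mulrDr !(mulrCA a).
Qed.

Lemma coin_mean_cst m a : E m (fun _ => a) = a.
Proof.
elim: m => [//|m IH] /=.
by rewrite (_ : _ \o _ = fun=> a)// IH -mulrDl addrC subrK mul1r.
Qed.

Lemma coin_meanB m g g' : E m (fun s => g s - g' s) = E m g - E m g'.
Proof.
rewrite coin_meanD; congr (_ + _); rewrite -mulN1r -coin_meanZ.
by apply: eq_coin_mean => s _; rewrite mulN1r.
Qed.

Hypothesis p01 : 0 <= p <= 1.

Lemma coin_mean_le m g g' :
  (forall s, size s = m -> g s <= g' s) -> E m g <= E m g'.
Proof.
have /andP[p0 p1] := p01.
elim: m g g' => [|m IH] g g' gg' /=; first exact: gg'.
by apply: lerD; apply: ler_wpM2l; rewrite ?subr_ge0//; apply: IH => s sm /=;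
  apply: gg'; rewrite /= sm.
Qed.

Lemma coin_mean_ge0 m g : (forall s, size s = m -> 0 <= g s) -> 0 <= E m g.
Proof. by move=> g0; rewrite -(coin_mean_cst m 0); exact: coin_mean_le. Qed.

Lemma norm_coin_mean m g : `|E m g| <= E m (fun s => `|g s|).
Proof.
rewrite ler_norml -mulN1r -coin_meanZ; apply/andP; split; apply: coin_mean_le => s _.
  by rewrite mulN1r lerNl -normrN ler_norm.
exact: ler_norm.
Qed.

Section count.
Variable b : bool.
Local Notation N := (count_mem b).

Lemma coin_mean_countS m (F : nat -> R) :
  E m.+1 (F \o N) = pr b * E m (fun s => F (N s).+1) + pr (~~ b) * E m (F \o N).
Proof.
rewrite (coin_meanS b); congr (_ * _ + _ * _).
  by apply: eq_coin_mean => s _ /=; rewrite eqxx.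
by apply: eq_coin_mean => s _ /=; case: b.
Qed.

(** Each of the coins contributes equally to [N F(N)], and it contributes only
    when it shows [b], in which case it adds one to the count of the others. *)
Lemma coin_mean_size_bias m (F : nat -> R) :
  E m.+1 (fun s => (N s)%:R * F (N s)) = m.+1%:R * pr b * E m (fun s => F (N s).+1).
Proof.
elim: m F => [|m IH] F.
  rewrite (coin_mean_countS 0 (fun k => k%:R * F k)) /=.
  by rewrite mul0r mulr0 addr0 !mul1r.
rewrite (coin_mean_countS _ (fun k => k%:R * F k)) IH.
under eq_coin_mean => s _.
  rewrite -natr1 mulrDl mul1r.
  over.
rewrite coin_meanD (IH (F \o S)) (coin_mean_countS m (F \o S)) /=.
rewrite -[in RHS](natr1 m.+1).
have := sum_bernoulli_pmf b.
set A := E m _; set B := E m _; set q := pr b; set q' := pr (~~ b).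
move=> qq; have -> : q' = 1 - q by rewrite -qq addrC addKr.
ring.
Qed.

Lemma coin_mean_count m : E m (fun s => (N s)%:R) = m%:R * pr b.
Proof.
case: m => [|m]; first by rewrite /= mul0r.
have := coin_mean_size_bias m (fun=> 1); rewrite coin_mean_cst mulr1 => <-.
by apply: eq_coin_mean => s _; rewrite mulr1.
Qed.

(** The discrete integration by parts behind Stein's method: size bias, from
    which the mean of [F(N)] is subtracted after conditioning on one coin. *)
Lemma coin_mean_centered m (F : nat -> R) :
  E m.+1 (fun s => ((N s)%:R - m.+1%:R * pr b) * F (N s)) =
  m.+1%:R * pr b * pr (~~ b) * E m (fun s => F (N s).+1 - F (N s)).
Proof.
under eq_coin_mean do rewrite mulrBl.
rewrite !coin_meanB (coin_mean_size_bias m F) coin_meanZ.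
rewrite (coin_mean_countS m F).
have <- : 1 - pr b = pr (~~ b) by rewrite -(sum_bernoulli_pmf b) addrC addKr.
rewrite /comp; ring.
Qed.

Lemma coin_var_count m :
  E m (fun s => ((N s)%:R - m%:R * pr b) ^+ 2) = m%:R * pr b * pr (~~ b).
Proof.
case: m => [|m]; first by rewrite /= !mul0r subrr expr0n.
under eq_coin_mean do rewrite expr2.
rewrite (coin_mean_centered m (fun k => k%:R - m.+1%:R * pr b)).
rewrite (@eq_coin_mean m _ (fun=> 1)) ?coin_mean_cst ?mulr1// => s _.
by rewrite -natr1; ring.
Qed.

End count.

Fixpoint adjacent_zeros (s : seq bool) : nat :=
  if s is b :: s' then (~~ b && ~~ head true s') + adjacent_zeros s' else 0.

(** Every zero either closes a run or is followed by another zero. *)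
Lemma zero_runsD s : (zero_runs s + adjacent_zeros s = count_mem false s)%N.
Proof.
elim: s => //= b s <-; rewrite addnACA; congr (_ + _)%N.
by case: b; case: (head _ _).
Qed.

Local Notation q := (1 - p).
Local Notation A s := ((adjacent_zeros s)%:R).
Local Notation Z0 s := ((~~ head true s)%:R).

Lemma coin_mean_head_zero m : E m.+1 (fun s => Z0 s) = q.
Proof.
rewrite (_ : E m.+1 _ = p * E m (fun=> 0) + q * E m (fun=> 1))//.
by rewrite !coin_mean_cst mulr0 add0r mulr1.
Qed.

Lemma coin_mean_adjacent_zeros m :
  E m.+1 (fun s => A s) = m%:R * q ^+ 2.
Proof.
elim: m => [|m IH]; first by rewrite /= !mulr0 addr0 mul0r.
have -> : E m.+2 (fun s => A s) =
    p * E m.+1 (fun s => A s) + q * E m.+1 (fun s => Z0 s + A s).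
  rewrite [LHS](coin_meanS true); congr (_ * _ + _ * _).
  by apply: eq_coin_mean => s _ /=; rewrite natrD.
rewrite coin_meanD !IH coin_mean_head_zero -natr1; ring.
Qed.

Lemma coin_mean_head_adjacent_zeros m :
  E m.+2 (fun s => Z0 s * A s) = q * (q + m%:R * q ^+ 2).
Proof.
have -> : E m.+2 (fun s => Z0 s * A s) =
    p * E m.+1 (fun=> 0) + q * E m.+1 (fun s => Z0 s + A s).
  rewrite (coin_meanS true); congr (_ * _ + _ * _); apply: eq_coin_mean => s _ /=.
    by rewrite mul0r.
  by rewrite mul1r natrD.
by rewrite coin_mean_cst mulr0 add0r coin_meanD coin_mean_head_zero coin_mean_adjacent_zeros.
Qed.

(** Adding a coin in front adds a pair exactly when this coin and the next one
    are zeros, so the variance grows by at most [q ^ 2 + 2 q ^ 3], the last term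
    coming from the covariance with the pair that starts at the next coin. *)
Lemma coin_var_adjacent_zeros m :
  E m.+1 (fun s => (A s - m%:R * q ^+ 2) ^+ 2) <= 3%:R * m%:R * q ^+ 2.
Proof.
have /andP[p0 p1] := p01.
have q0 : 0 <= q by rewrite subr_ge0.
have q1 : q <= 1 by rewrite lerBlDr lerDl.
elim: m => [|m IH].
  by rewrite /= !mul0r subrr expr0n /= !mulr0 addr0 mul0r.
have -> : E m.+2 (fun s => (A s - m.+1%:R * q ^+ 2) ^+ 2) =
    p * E m.+1 (fun s => (A s - m.+1%:R * q ^+ 2) ^+ 2) +
    q * E m.+1 (fun s => (Z0 s + A s - m.+1%:R * q ^+ 2) ^+ 2).
  rewrite (coin_meanS true); congr (_ * _ + _ * _).
  by apply: eq_coin_mean => s _ /=; rewrite natrD.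
set a := m%:R * q ^+ 2 in IH *.
have aS : m.+1%:R * q ^+ 2 = a + q ^+ 2 by rewrite -natr1 mulrDl mul1r.
rewrite aS.
pose V := E m.+1 (fun s => (A s - a) ^+ 2).
have EA : E m.+1 (fun s => A s - a) = 0.
  by rewrite coin_meanB coin_mean_adjacent_zeros coin_mean_cst subrr.
have -> : E m.+1 (fun s => (A s - (a + q ^+ 2)) ^+ 2) = V + q ^+ 4.
  have -> : E m.+1 (fun s => (A s - (a + q ^+ 2)) ^+ 2) =
      E m.+1 (fun s => (A s - a) ^+ 2 + ((- 2 * q ^+ 2) * (A s - a) + q ^+ 4)).
    by apply: eq_coin_mean => s _; ring.
  by rewrite !coin_meanD coin_meanZ EA coin_mean_cst mulr0 add0r.
pose U := E m.+1 (fun s => Z0 s * A s).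
have -> : E m.+1 (fun s => (Z0 s + A s - (a + q ^+ 2)) ^+ 2) =
    V + q ^+ 4 + 2 * U + (1 - 2 * (a + q ^+ 2)) * q.
  have -> : E m.+1 (fun s => (Z0 s + A s - (a + q ^+ 2)) ^+ 2) =
      E m.+1 (fun s => (A s - a) ^+ 2 + ((- 2 * q ^+ 2) * (A s - a) + (q ^+ 4 +
         (2 * (Z0 s * A s) + (1 - 2 * (a + q ^+ 2)) * Z0 s)))).
    by apply: eq_coin_mean => s _; case: (head true s) => /=; ring.
  by rewrite !coin_meanD !coin_meanZ EA coin_mean_head_zero coin_mean_cst mulr0 add0r !addrA.
have U_le : U <= q * (q + a).
  rewrite /U /a; case: (m) => [|k].
    rewrite (_ : E 1 _ = 0); last by rewrite /= !mulr0 addr0.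
    by rewrite mul0r addr0 mulr_ge0.
  rewrite coin_mean_head_adjacent_zeros -natr1.
  have : 0 <= q ^+ 3 by rewrite exprn_ge0.
  lra.
have VE : V <= 3 * m%:R * q ^+ 2 := IH.
have -> : 3 * m.+1%:R * q ^+ 2 = 3 * m%:R * q ^+ 2 + 3 * q ^+ 2.
  by rewrite -natr1; ring.
have qU : q * U <= q ^+ 3 + a * q ^+ 2.
  by rewrite [leRHS](_ : _ = q * (q * (q + a))) ?ler_wpM2l//; ring.
have q3 : q ^+ 3 <= q ^+ 2 by rewrite exprSr ler_piMr// exprn_ge0.
have q4 : 0 <= q ^+ 4 by rewrite exprn_ge0.
rewrite [leLHS](_ : _ = V + 2 * (q * U) + q ^+ 2 - 2 * (a * q ^+ 2) - q ^+ 4); last by ring.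
lra.
Qed.
End coin_mean.

(** * From the probability space to finite means *)

(** Listing the sequences in this order makes sums over them follow the recursion
    of [coin_mean]. *)
Fixpoint all_bit_seqs (m : nat) : seq (seq bool) :=
  if m is m'.+1 then
    map (cons true) (all_bit_seqs m') ++ map (cons false) (all_bit_seqs m')
  else [:: [::]].

Lemma mem_all_bit_seqs m v : (v \in all_bit_seqs m) = (size v == m).
Proof.
elim: m v => [|m IH] [|b v] //=; rewrite mem_cat.
  by apply/negbTE; rewrite negb_or; apply/andP; split; apply/mapP => -[].
rewrite eqSS -IH; apply/orP/idP => [[] /mapP[u um [_ ->]]//|vm].
by case: b; [left|right]; exact: map_f.
Qed.

Lemma coin_mean_sum (R : realType) (p : R) m (g : seq bool -> R) :
  coin_mean p m g =
  \sum_(v <- all_bit_seqs m) (\prod_(b <- v) bernoulli_pmf p b) * g v.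
Proof.
elim: m g => [|m IH] g /=; first by rewrite big_seq1 big_nil mul1r.
rewrite big_cat !big_map /= !IH !mulr_sumr.
by congr (_ + _); apply: eq_bigr => v _; rewrite big_cons mulrA.
Qed.

Lemma sum_all_bit_seqs (R : realType) m (g : seq bool -> R) s : size s = m ->
  g s = \sum_(v <- all_bit_seqs m) g v * (s == v)%:R.
Proof.
elim: m g s => [|m IH] g [|b s] //=; first by rewrite big_seq1 eqxx mulr1.
move=> [sm]; rewrite big_cat !big_map /=.
under eq_bigr do rewrite eqseq_cons.
under [X in _ = _ + X]eq_bigr do rewrite eqseq_cons.
case: b => /=.
  rewrite [X in _ + X]big1 ?addr0; last by move=> v _; rewrite mulr0.
  exact: (IH (g \o cons true)).
rewrite [X in X + _]big1 ?add0r; last by move=> v _; rewrite mulr0.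
exact: (IH (g \o cons false)).
Qed.

Section transfer.
Context d (T : measurableType d) (R : realType) (P : probability T R).
Variables (n : nat) (p : R) (eps : nat -> {RV P >-> bool}).
Hypotheses (p01 : 0 <= p <= 1) (coins_eps : shuffle_coins n p eps).

Definition coin_seq (w : T) : seq bool := [seq eps j w | j <- iota 1 n.-1].

Lemma coin_seq_eqE (v : seq bool) : size v = n.-1 ->
  [set w | coin_seq w = v] =
  \bigcap_(i in [set i : 'I_n.-1 | i \in [set: 'I_n.-1]%SET])
    eps i.+1 @^-1` [set nth false v i].
Proof.
move=> sv; apply/seteqP; split => [w /= wv i _|w wv] /=.
  by rewrite -wv (nth_map 0%N) ?size_iota// nth_iota// add1n.
apply: (@eq_from_nth _ false); rewrite size_map size_iota // => i im.
rewrite (nth_map 0%N) ?size_iota// nth_iota// add1n.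
by have := wv (Ordinal im); rewrite /= finset.inE; exact.
Qed.

Lemma size_coin_seq w : size (coin_seq w) = n.-1.
Proof. by rewrite size_map size_iota. Qed.

Lemma measurable_coin_seq_eq (v : seq bool) : measurable [set w | coin_seq w = v].
Proof.
have [sv|sv] := eqVneq (size v) n.-1; last first.
  rewrite (_ : [set _ | _] = set0)//; apply/seteqP; split => // w /= wv.
  by rewrite -wv size_coin_seq eqxx in sv.
rewrite coin_seq_eqE//.
apply: fin_bigcap_measurable; first exact: finite_finset.
by move=> i _; rewrite -[X in measurable X]setTI; exact: measurable_funPT.
Qed.

(** This is where independence enters, for the family of all the coins. *)
Lemma probability_coin_seq (v : seq bool) : size v = n.-1 ->
  P [set w | coin_seq w = v] = (\prod_(b <- v) bernoulli_pmf p b)%:E.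
Proof.
move=> sv; have [dist indep] := coins_eps; rewrite coin_seq_eqE//.
rewrite (indep [set: 'I_n.-1]%SET (fun i : 'I_n.-1 => [set nth false v i]))//.
rewrite (big_nth false) sv big_mkord -prodEFin.
apply: eq_big => [i|i _]; first by rewrite finset.inE.
have := dist i => /(congr1 (fun mu => mu [set nth false v i])).
rewrite /distribution /pushforward /= => ->.
by rewrite /bernoulli_prob p01 fsbig_set1.
Qed.

Lemma integral_coin_seq (g : seq bool -> R) :
  (\int[P]_w (g (coin_seq w))%:E = (coin_mean p n.-1 g)%:E)%E.
Proof.
have indicE v w : (coin_seq w == v)%:R = \1_[set w | coin_seq w = v] w :> R.
  by rewrite indicE; case: eqP => h; [rewrite mem_set|rewrite memNset].
under eq_integral => w _.
  rewrite (sum_all_bit_seqs g (size_coin_seq w)) -sumEFin.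
  under eq_bigr do rewrite indicE EFinM.
  over.
have int1 v : P.-integrable setT (fun w => (\1_[set w | coin_seq w = v] w)%:E).
  exact/integrable_indic/measurable_coin_seq_eq.
rewrite integral_sum//; last by move=> v; exact: integrableZl.
rewrite coin_mean_sum -sumEFin big_seq [RHS]big_seq.
apply: eq_bigr => v; rewrite mem_all_bit_seqs => /eqP sv.
rewrite integralZl// integral_indic//; last exact: measurable_coin_seq_eq.
rewrite setIT EFinM [RHS]muleC; congr (_ * _)%E; exact: probability_coin_seq.
Qed.

Lemma probability_coin_pred (B : pred (seq bool)) :
  P [set w | B (coin_seq w)] = (coin_mean p n.-1 (fun s => (B s)%:R))%:E.
Proof.
have mB : measurable [set w | B (coin_seq w)].
  rewrite (_ : [set _ | _] = \bigcup_(v in [set` [seq v <- all_bit_seqs n.-1 | B v]])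
      [set w | coin_seq w = v]).
    by apply: fin_bigcup_measurable => // v _; exact: measurable_coin_seq_eq.
  apply/seteqP; split => [w /= Bw|w [v /= + ->]].
    by exists (coin_seq w) => //; rewrite /= mem_filter mem_all_bit_seqs size_coin_seq Bw eqxx.
  by rewrite mem_filter => /andP[].
rewrite -integral_coin_seq -[in LHS](setIT [set w | _]) -integral_indic//.
apply: eq_integral => w _; rewrite indicE; congr (_%:R)%:E.
by have [h|h] := boolP (B _); [rewrite mem_set|rewrite memNset//; exact/negP].
Qed.

Lemma expectation_coin_seq (g : seq bool -> R) :
  ('E_P[g \o coin_seq])%E = (coin_mean p n.-1 g)%:E.
Proof. by rewrite unlock integral_coin_seq. Qed.

Lemma variance_coin_seq (g : seq bool -> R) :
  ('V_P[g \o coin_seq])%E =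
  (coin_mean p n.-1 (fun s => (g s - coin_mean p n.-1 g) ^+ 2))%:E.
Proof.
rewrite /variance unlock expectation_coin_seq /= -expectation_coin_seq.
by congr expectation; apply/funext => w; rewrite /= expr2.
Qed.

End transfer.

(** * The Poisson limit *)

Section poisson_limit.
Context {R : realType}.
Implicit Types (p : R) (m k : nat).
Local Notation Z s := (count_mem false s).
Local Notation binom p m k := (coin_mean p m (fun s => (Z s == k)%:R)).

Lemma coin_mean_no_zero p m : binom p m 0%N = p ^+ m.
Proof.
elim: m => [|m IH]; first by rewrite /= expr0.
rewrite (coin_mean_countS p false m (fun j => (j == 0%N)%:R)) /=.
by rewrite coin_mean_cst mulr0 add0r IH exprS.
Qed.

(** Size bias for the indicator of [k.+1]. *)
Lemma coin_mean_zerosS p m k :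
  binom p m k.+1 = m%:R * (1 - p) / k.+1%:R * binom p m.-1 k.
Proof.
case: m => [|m]; first by rewrite /= !mul0r.
have k0 : k.+1%:R != 0 :> R by rewrite pnatr_eq0.
apply: (mulfI k0); rewrite -coin_meanZ.
have := coin_mean_size_bias p false m (fun j => (j == k.+1)%:R).
rewrite [bernoulli_pmf _ _]/= => bias.
rewrite (mulrA k.+1%:R) (mulrCA k.+1%:R) mulrC divff// mulr1.
rewrite mulrC; transitivity (coin_mean p m.+1 (fun s => (Z s)%:R * (Z s == k.+1)%:R)) => //.

by apply: eq_coin_mean => s _; case: eqP => [->//|_]; rewrite !mulr0.
Qed.

(** From [1 + x <= exp x], used at [- q] and at [q / (1 - q)], the power lies
    between [exp (- m q / (1 - q))] and [exp (- m q)]. *)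
Lemma cvg_exprn_expR (lambda : R) (q : nat -> R) (m : nat -> nat) :
  (\forall n \near \oo, 0 <= q n) ->
  q n @[n --> \oo] --> 0 -> (m n)%:R * q n @[n --> \oo] --> lambda ->
  (1 - q n) ^+ m n @[n --> \oo] --> expR (- lambda).
Proof.
move=> q0 cq cmq.
have up : expR (- ((m n)%:R * q n)) @[n --> \oo] --> expR (- lambda).
  by apply: continuous_cvg; [exact: continuous_expR|exact: cvgN].
have low : expR (- ((m n)%:R * q n / (1 - q n))) @[n --> \oo] --> expR (- lambda).
  apply: continuous_cvg; first exact: continuous_expR.
  apply: cvgN; rewrite -[X in _ --> X]divr1; apply: cvgM => //.
  apply: cvgV => //; rewrite -[X in _ --> X]subr0; apply: cvgB => //.
  exact: cvg_cst.
apply: squeeze_cvgr low up.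
near=> n.
have qn0 : 0 <= q n by near: n.
have qn1 : q n < 1 by near: n; apply: cvgr_lt cq _ _.
have q1 : 0 < 1 - q n by rewrite subr_gt0.
rewrite -mulrA -!mulrN !expRM_natl.
apply/andP; split; apply: lerXn2r; rewrite ?nnegrE ?expR_ge0 ?(ltW q1)//.
  rewrite mulrN -[leRHS]invrK expRN lef_pV2 ?posrE ?invr_gt0 ?expR_gt0//.
  apply: le_trans (expR_ge1Dx _); rewrite le_eqVlt; apply/orP; left; apply/eqP.
  by field; rewrite gt_eqF.
exact: expR_ge1Dx.
Unshelve. all: by end_near. Qed.

Theorem cvg_binomial_poisson (lambda : R) (q : nat -> R) (m : nat -> nat) k :
  0 < lambda -> (\forall n \near \oo, 0 <= q n) ->
  q n @[n --> \oo] --> 0 -> (m n)%:R * q n @[n --> \oo] --> lambda ->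
  binom (1 - q n) (m n) k @[n --> \oo] --> poisson_pmf lambda k.
Proof.
move=> l0 q0 cq; elim: k m => [|k IH] m cmq.
  under eq_cvg do rewrite coin_mean_no_zero.
  rewrite /poisson_pmf l0 expr0 fact0 invr1 !mul1r.
  exact: cvg_exprn_expR.
under eq_cvg do rewrite coin_mean_zerosS subKr.
have -> : poisson_pmf lambda k.+1 = lambda / k.+1%:R * poisson_pmf lambda k.
  rewrite /poisson_pmf l0 factS exprS natrM invfM. ring.
apply: cvgM.
  by apply: cvgM => //; exact: cvg_cst.
apply: IH.
have m0 : \forall n \near \oo, (0 < m n)%N.
  have : \forall n \near \oo, 0 < (m n)%:R * q n by exact: cvgr_gt cmq _ l0.
  by apply: filterS => n; case: (m n) => //; rewrite mul0r ltxx.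
have : (m n)%:R * q n - q n @[n --> \oo] --> lambda.
  by rewrite -[X in _ --> X]subr0; exact: cvgB.
apply: cvg_trans; apply: near_eq_cvg.
near=> n.
have : (0 < m n)%N by near: n.
by case: (m n) => // j _; rewrite -natr1 /=; ring.
Unshelve. all: by end_near. Qed.

(** The two counts differ only if two consecutive zeros exist, which has
    probability at most the mean number of such pairs. *)
Lemma coin_mean_zero_runs_close p m (B : pred nat) : 0 <= p <= 1 ->
  `|coin_mean p m.+1 (fun s => (B (zero_runs s))%:R) -
    coin_mean p m.+1 (fun s => (B (Z s))%:R)| <= m%:R * (1 - p) ^+ 2.
Proof.
move=> p01; rewrite -coin_meanB -coin_mean_adjacent_zeros.
apply: le_trans (norm_coin_mean p01 _ _) _.
apply: coin_mean_le => // s _; rewrite -zero_runsD.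
case: (adjacent_zeros s) => [|a]; first by rewrite addn0 subrr normr0.
apply: (@le_trans _ _ 1); last by rewrite ler1n.
by case: (B _); case: (B _); rewrite ?subrr ?subr0 ?sub0r ?normrN ?normr0 ?normr1.
Qed.

Lemma coin_mean_zero_runs_le p m : 0 <= p <= 1 ->
  coin_mean p m (fun s => (zero_runs s)%:R) <= m%:R * (1 - p).
Proof.
move=> p01; rewrite -(coin_mean_count p false); apply: coin_mean_le => // s _.
by rewrite ler_nat -zero_runsD leq_addr.
Qed.

Lemma coin_mean_zeros_lt p m K :
  coin_mean p m (fun s => (Z s < K)%N%:R) = \sum_(k < K) binom p m k.
Proof.
elim: K => [|K IH]; first by rewrite big_ord0 coin_mean_cst.
rewrite big_ord_recr /= -IH -coin_meanD; apply: eq_coin_mean => s _.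
by rewrite ltnS leq_eqVlt -natrD; case: ltngtP.
Qed.

Lemma cdf_poisson (lambda x : R) (K : nat) : 0 < lambda ->
  (forall k, (k%:R <= x) = (k < K)%N) ->
  cdf (poisson_RV lambda) x = (\sum_(k < K) poisson_pmf lambda k)%:E.
Proof.
move=> l0 xK; rewrite /cdf /distribution /pushforward /= /poisson_law /poisson_prob l0.
rewrite (_ : _ @^-1` _ = `I_K); last first.
  by apply/seteqP; split => k /=; rewrite in_itv /= /nat_embedding xK.
rewrite esum_fset; last by move=> k _; rewrite lee_fin poisson_pmf_ge0.
  by rewrite -fsbig_ord sumEFin.
exact: finite_II.
Qed.

(** The correction from zeros to runs of zeros is at most [m q ^ 2], and
    [m q ^ 2 = (m q) q] tends to [0]. *)
Theorem cvg_zero_runs_poisson (lambda : R) (q : nat -> R) (m : nat -> nat) (x : R) :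
  0 < lambda -> (\forall n \near \oo, 0 <= q n) ->
  q n @[n --> \oo] --> 0 -> (m n)%:R * q n @[n --> \oo] --> lambda ->
  (coin_mean (1 - q n) (m n) (fun s => ((zero_runs s)%:R <= x)%R%:R))%:E
    @[n --> \oo] --> cdf (poisson_RV lambda) x.
Proof.
move=> l0 q0 cq cmq.
have [K xK] : exists K, forall k, (k%:R <= x) = (k < K)%N.
  have [x0|x0] := ltP x 0.
    by exists 0%N => k; rewrite ltn0; apply/negbTE; rewrite -ltNge (lt_le_trans x0).
  by exists (Num.truncn x).+1 => k; rewrite ltnS truncn_ge_nat.
rewrite (cdf_poisson l0 xK).
suff cruns : coin_mean (1 - q n) (m n) (fun s => ((zero_runs s)%:R <= x)%R%:R)
    @[n --> \oo] --> \sum_(k < K) poisson_pmf lambda k.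
  by apply: cvg_EFin; [exact: nearW|exact: cruns].
have cZ : coin_mean (1 - q n) (m n) (fun s => (Z s < K)%N%:R) @[n --> \oo]
    --> \sum_(k < K) poisson_pmf lambda k.
  under eq_cvg do rewrite coin_mean_zeros_lt.
  by apply: cvg_big => [|k _]; [exact: add_continuous|exact: cvg_binomial_poisson].
pose err n := coin_mean (1 - q n) (m n) (fun s => ((zero_runs s)%:R <= x)%R%:R) -
  coin_mean (1 - q n) (m n) (fun s => (Z s < K)%N%:R).
suff cerr : err n @[n --> \oo] --> 0.
  have e n : coin_mean (1 - q n) (m n) (fun s => ((zero_runs s)%:R <= x)%R%:R) =
      coin_mean (1 - q n) (m n) (fun s => (Z s < K)%N%:R) + err n.
    by rewrite /err [RHS]addrC subrK.
  by rewrite -[X in _ --> X]addr0 (eq_cvg _ _ e); exact: cvgD.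
have cB : (m n)%:R * q n * q n @[n --> \oo] --> 0.
  by rewrite -(mulr0 lambda); exact: cvgM.
apply/norm_cvg0P.
apply: squeeze_cvgr (cvg_cst 0) cB.
near=> n; rewrite normr_ge0 /= /err.
have qn0 : 0 <= q n by near: n.
have qn1 : q n < 1 by near: n; apply: cvgr_lt cq _ _.
case: (m n) => [|j]; first by rewrite /= xK subrr normr0 !mul0r.
have p01 : 0 <= 1 - q n <= 1 by rewrite subr_ge0 gerBl qn0 ltW.
under eq_coin_mean do rewrite xK.
apply: le_trans (coin_mean_zero_runs_close j (fun k => (k < K)%N) p01) _.
by rewrite subKr expr2 -mulrA ler_wpM2r ?mulr_ge0// ler_nat.
Unshelve. all: by end_near. Qed.

End poisson_limit.

(** * Stein's equation for the standard normal law *)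

Section std_normal_density.
Context {R : realType}.
Local Notation mu := (@lebesgue_measure R).
Implicit Types x w : R.

Definition std_normal_pdf : R -> R := normal_pdf 0 1.

Local Notation phi := std_normal_pdf.

Lemma std_normal_pdfE x : phi x = normal_peak 1 * expR (- (x ^+ 2 / 2)).
Proof.
by rewrite /std_normal_pdf normal_pdfE ?oner_eq0// /normal_fun subr0 expr1n mulNr.
Qed.

Lemma std_normal_pdf_gt0 x : 0 < phi x.
Proof. by rewrite std_normal_pdfE mulr_gt0 ?expR_gt0 ?normal_peak_gt0 ?oner_eq0. Qed.

Lemma std_normal_pdf_neq0 x : phi x != 0.
Proof. by rewrite gt_eqF ?std_normal_pdf_gt0. Qed.

Lemma std_normal_pdfN x : phi (- x) = phi x.
Proof. by rewrite !std_normal_pdfE sqrrN. Qed.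

Lemma le_std_normal_pdf x w : `|x| <= `|w| -> phi w <= phi x.
Proof.
move=> xw; rewrite !std_normal_pdfE ler_wpM2l ?normal_peak_ge0// ler_expR.
rewrite lerN2 ler_pM2r ?invr_gt0// -(real_normK (num_real x)).
by rewrite -(real_normK (num_real w)) lerXn2r ?nnegrE.
Qed.

Lemma is_derive_std_normal_pdf x : is_derive x 1 phi (- x * phi x).
Proof.
have -> : phi = (fun y => normal_peak 1 * expR (- (y ^+ 2 / 2))).
  by apply/funext => y; exact: std_normal_pdfE.
apply: is_derive_eq.
by rewrite /GRing.scale /=; field.
Qed.

Lemma continuous_std_normal_pdf : continuous phi.
Proof. by apply: continuous_normal_pdf; rewrite oner_eq0. Qed.

Lemma std_normal_pdf_cvgy : phi x @[x --> +oo] --> 0.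
Proof.
rewrite (_ : phi = fun x => normal_peak 1 * expR (- (x ^+ 2 / 2))); last first.
  by apply/funext => x; exact: std_normal_pdfE.
rewrite -[X in _ --> X](mulr0 (normal_peak 1)).
apply: cvgMl_tmp.
apply: (cvg_comp (fun x => x ^+ 2 / 2) (fun x => expR (- x))); last exact: cvgr_expR.
by apply/gt0_cvgMly; [rewrite invr_gt0|exact: cvgr_expr2].
Qed.

(** On the domain of integration [w <= x], and [x * phi x] has the primitive
    [- phi x]. *)
Lemma mills_ratio w : 0 < w ->
  (w%:E * \int[mu]_(x in `[w, +oo[) (phi x)%:E <= (phi w)%:E)%E.
Proof.
move=> w0.
have mphi D : measurable_fun D phi.
  by apply: measurable_funTS; exact: measurable_normal_pdf.
rewrite -ge0_integralZl//; last 3 first.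
- by apply/measurable_EFinP; exact: mphi.
- by move=> x _; rewrite lee_fin ltW ?std_normal_pdf_gt0.
- by rewrite lee_fin ltW.
have <- : (\int[mu]_(x in `[w, +oo[) (x * phi x)%:E = (phi w)%:E)%E.
  rewrite (@ge0_continuous_FTC2y _ _ (fun x => - phi x) _ 0).
  - by rewrite sub0e -EFinN opprK.
  - move=> x wx; rewrite mulr_ge0 ?(ltW (std_normal_pdf_gt0 _))//.
    exact: le_trans (ltW w0) wx.
  - apply: continuous_subspaceT => x; apply: cvgM; first exact: cvg_id.
    exact: continuous_std_normal_pdf.
  - by rewrite -oppr0; apply: cvgN; exact: std_normal_pdf_cvgy.
  - by move=> x _; apply: derivableN; have [] := is_derive_std_normal_pdf x.
  - apply: cvg_at_right_filter; apply: cvgN; exact: continuous_std_normal_pdf.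
  - move=> x _; rewrite derive1E.
    have := is_derive_std_normal_pdf x => dphi.
    by rewrite derive_val mulNr opprK.
apply: ge0_le_integral => //.

- by move=> x _; rewrite mule_ge0 ?lee_fin ?(ltW w0)// ltW ?std_normal_pdf_gt0.
- by apply: measurable_funeM; apply/measurable_EFinP; exact: mphi.
- by apply/measurable_EFinP; apply: measurable_funM => //; exact: mphi.
- move=> x /=; rewrite in_itv/= andbT => wx.
  by rewrite lee_fin ler_pM2r ?std_normal_pdf_gt0.
Qed.

Lemma mills_ratioN w : w < 0 ->
  ((- w)%:E * \int[mu]_(x in `]-oo, w]) (phi x)%:E <= (phi w)%:E)%E.
Proof.
move=> w0; rewrite -{1 2}(opprK w) ge0_integration_by_substitutionNy; last 2 first.
- exact/continuous_subspaceT/continuous_std_normal_pdf.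
- by move=> x _; rewrite ltW ?std_normal_pdf_gt0.
rewrite opprK -(std_normal_pdfN w).
under eq_integral do rewrite /= std_normal_pdfN.
by apply: mills_ratio; rewrite oppr_gt0.
Qed.

End std_normal_density.

Section stein_equation.
Context {R : realType}.
Local Notation mu := (@lebesgue_measure R).
Local Notation phi := (@std_normal_pdf R).
Variable h : R -> R.
Hypotheses (h_cont : continuous h) (h01 : forall x, 0 <= h x <= 1).

Definition std_normal_mean : R := \int[mu]_x (h x * phi x).

Local Notation c := std_normal_mean.

Let g x := (h x - c) * phi x.

Let int_phi : mu.-integrable setT (EFin \o phi).
Proof. exact: integrable_normal_pdf. Qed.

Let Rint_phi : \int[mu]_x phi x = 1.
Proof. by rewrite /Rintegral integral_normal_pdf. Qed.

Let phi_le_integrable (k : R -> R) : continuous k ->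
  (forall x, `|k x| <= 1) -> mu.-integrable setT (EFin \o (k \* phi)).
Proof.
move=> k_cont k1; apply: le_integrable int_phi => //.
  apply/measurable_EFinP; apply: continuous_measurable_fun => x.
  by apply: cvgM; [exact: k_cont|exact: continuous_std_normal_pdf].
move=> x _ /=; rewrite lee_fin normrM ler_piMl ?normr_ge0//.
Qed.

Lemma std_normal_mean01 : 0 <= c <= 1.
Proof.
apply/andP; split.
  apply: Rintegral_ge0 => x _; rewrite mulr_ge0 ?(ltW (std_normal_pdf_gt0 _))//.
  by case/andP: (h01 x).
rewrite -Rint_phi; apply: le_Rintegral => //.
  apply: phi_le_integrable => // x; case/andP: (h01 x) => h0 h1.
  by rewrite ger0_norm.
move=> x _; rewrite ler_piMl ?(ltW (std_normal_pdf_gt0 _))//.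
by case/andP: (h01 x).
Qed.

Lemma std_normal_dev1 x : `|h x - c| <= 1.
Proof.
case/andP: (h01 x) => h0 h1; case/andP: std_normal_mean01 => c0 c1.
by rewrite ler_norml; apply/andP; split; lra.
Qed.

Let cont_dev : continuous (fun x => h x - c).
Proof. by move=> x; apply: cvgB; [exact: h_cont|exact: cvg_cst]. Qed.

Let int_g : mu.-integrable setT (EFin \o g).
Proof. by apply: phi_le_integrable => // x; exact: std_normal_dev1. Qed.

Let Rint_g : \int[mu]_x g x = 0.
Proof.
rewrite /g; under eq_Rintegral do rewrite mulrBl.
rewrite RintegralB//.
- by rewrite RintegralZl// Rint_phi mulr1 subrr.
- apply: phi_le_integrable => // x; case/andP: (h01 x) => h0 h1.
  by rewrite ger0_norm.
- apply: (@phi_le_integrable (cst c)) => //; first by move=> ?; exact: cvg_cst.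
  by move=> x /=; case/andP: std_normal_mean01 => c0 c1; rewrite ger0_norm.
Qed.

Let norm_Rint_g D : measurable D ->
  `|\int[mu]_(x in D) g x| <= \int[mu]_(x in D) phi x.
Proof.
move=> mD.
have iD k : mu.-integrable setT (EFin \o k) -> mu.-integrable D (EFin \o k).
  exact: integrableS.
apply: le_trans (le_normr_Rintegral mD (iD _ int_g)) _.
apply: le_Rintegral => //.
- apply/iD; rewrite (_ : _ \o _ = (fun x => `|(EFin \o g) x|%E))//.
  exact: integrable_abse.
- exact: iD.
- move=> x _; rewrite normrM (gtr0_norm (std_normal_pdf_gt0 _)).
  by rewrite ler_piMl ?std_normal_dev1// ltW ?std_normal_pdf_gt0.
Qed.

Let G w := \int[mu]_(x in `]-oo, w]) g x.

Let G_tail w : G w = - \int[mu]_(x in `[w, +oo[) g x.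
Proof.
rewrite -Rintegral_itv_obnd_cbnd; last exact: integrableS int_g.
rewrite -(@Rintegral_itvB _ g -oo%O +oo%O)//; last by rewrite set_itvE.
by rewrite set_itvE Rint_g sub0r opprK.
Qed.

Let norm_G1 w : `|G w| <= 1.
Proof.
apply: le_trans (norm_Rint_g _) _ => //; rewrite -Rint_phi.
rewrite /Rintegral fine_le ?integrable_fin_num//; first exact: integrableS int_phi.
apply: ge0_subset_integral => //; first by case/integrableP: int_phi.
by move=> x _; rewrite lee_fin ltW ?std_normal_pdf_gt0.
Qed.

Let norm_wG (w : R) : `|w * G w| <= phi w.
Proof.
have fin_int D : measurable D -> (\int[mu]_(x in D) (phi x)%:E)%E \is a fin_num.
  by move=> mD; apply: integrable_fin_num => //; exact: integrableS int_phi.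
rewrite normrM; case: (ltgtP w 0) => [w0|w0|->]; last first.
- by rewrite normr0 mul0r ltW ?std_normal_pdf_gt0.
- rewrite G_tail normrN (gtr0_norm w0).
  apply: (@le_trans _ _ (w * \int[mu]_(x in `[w, +oo[) phi x)).
    by rewrite ler_wpM2l ?norm_Rint_g// ltW.
  by rewrite -lee_fin EFinM fineK ?fin_int// mills_ratio.
- rewrite (ltr0_norm w0).
  apply: (@le_trans _ _ (- w * \int[mu]_(x in `]-oo, w]) phi x)).
    by rewrite ler_wpM2l ?norm_Rint_g// oppr_ge0 ltW.
  by rewrite -lee_fin EFinM fineK ?fin_int// mills_ratioN.
Qed.

Let is_derive_G (w : R) : is_derive w 1 G (g w).
Proof.
have [||||dG <-] := @continuous_FTC1 R g -oo%O w (w + 1).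
- by rewrite ltrDl.
- exact: integrableS int_g.
- by rewrite ltNyr.
- by apply: cvgM; [exact: cont_dev|exact: continuous_std_normal_pdf].
by rewrite derive1E; exact/derivableP.
Qed.

(** The solution is [G / phi], where [G w] integrates [(h - c) phi] up to [w].
    As [(h - c) phi] has integral [0], [G w] is also the opposite of the integral
    from [w] on, so that Mills' inequality bounds [w * f w] on both sides. *)
Theorem stein_solution : exists f : R -> R,
  [/\ forall w : R, is_derive w 1 f (w * f w + (h w - c)),
      forall w, `|w * f w| <= 1 &
      exists C, forall w, `|f w| <= C].
Proof.
exists (fun w => G w / phi w).
have wf1 w : `|w * (G w / phi w)| <= 1.
  rewrite mulrA normrM normfV (gtr0_norm (std_normal_pdf_gt0 _)).
  by rewrite ler_pdivrMr ?std_normal_pdf_gt0// mul1r.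
split => //.
- move=> w; have dG := is_derive_G w; have dp := is_derive_std_normal_pdf w.
  have p0 := std_normal_pdf_neq0 w.
  have dV := is_deriveV p0.
  apply: is_derive_eq.
  rewrite /GRing.scale/= /g. by field.
- exists (1 + (phi 1)^-1) => w.
  have p1 : 0 <= (phi 1)^-1 by rewrite invr_ge0 ltW ?std_normal_pdf_gt0.
  have [w1|w1] := leP 1 `|w|.
    apply: (@le_trans _ _ 1); last by rewrite lerDl.
    apply: le_trans (wf1 w).
    by rewrite [leRHS]normrM ler_peMl.
  apply: (@le_trans _ _ (phi 1)^-1); last by rewrite lerDr.
  rewrite normrM -[leRHS]mul1r ler_pM//.
  rewrite normfV (gtr0_norm (std_normal_pdf_gt0 _)) lef_pV2 ?posrE ?std_normal_pdf_gt0//.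
  by rewrite le_std_normal_pdf// normr1 ltW.
Qed.

End stein_equation.

(** * Quantitative central limit theorems *)

Section clt.
Context {R : realType}.
Implicit Types (p : R) (m : nat).
Local Notation N s := ((count_mem true s)%:R).
Local Notation A s := ((adjacent_zeros s)%:R).

Lemma lipschitz_continuous (h : R -> R) (L : R) :
  (forall x y, `|h x - h y| <= L * `|x - y|) -> continuous h.
Proof.
move=> hL x; apply/cvgrPdist_le => /= e e0.
have L1 : 0 < `|L| + 1 by rewrite ltr_wpDl.
near=> y; apply: le_trans (hL x y) _.
apply: (@le_trans _ _ ((`|L| + 1) * `|x - y|)).
  by rewrite ler_wpM2r// (le_trans (ler_norm L))// lerDl.
rewrite mulrC -ler_pdivlMr//; near: y.
by apply: cvgr_dist_le => //; rewrite divr_gt0.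
Unshelve. all: by end_near. Qed.

Lemma mean_value (f f' : R -> R) (a b : R) : a < b ->
  (forall x : R, is_derive x 1 f (f' x)) ->
  exists2 c, a < c < b & f b - f a = f' c * (b - a).
Proof.
move=> ab df.
have cf : {within `[a, b], continuous f}.
  apply: continuous_subspaceT => x; apply: differentiable_continuous.
  by apply/derivable1_diffP; have [] := df x.
by have [c cab ->] := MVT ab (fun x _ => df x) cf; exists c.
Qed.

(** The error between [f'(w)] and a difference quotient of [f] near [w] is
    controlled without second derivatives: as [f'(w) = w f(w) + h(w) - c], with
    [f], [w f(w)] bounded and [h] Lipschitz, [f'] varies by at most
    [(C + 2 |v| + L) |u - v|] between [u] and [v], and the mean of [|v|] is
    bounded through the variance. *)
Theorem binomial_clt_bound (h : R -> R) (L : R) :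
  (forall x, 0 <= h x <= 1) ->
  (forall x y, `|h x - h y| <= L * `|x - y|) ->
  exists K, forall p m sigma, 0 <= p <= 1 -> 1 <= sigma ->
    sigma ^+ 2 = m.+1%:R * p * (1 - p) ->
    `|coin_mean p m.+1 (fun s => h ((N s - m.+1%:R * p) / sigma))
      - std_normal_mean h| <= K / sigma.
Proof.
move=> h01 hL; have [f [df wf1 [C fC]]] :=
  stein_solution (lipschitz_continuous hL) h01.
set c := std_normal_mean h in df *.
have [f' f'E {}df] : exists2 f' : R -> R,
    forall w, f' w = w * f w + (h w - c) & forall w : R, is_derive w 1 f (f' w).
  by exists (fun w => w * f w + (h w - c)).
exists (2 * (C + L + 6)) => p m sigma p01 s1 s2.
have s0 : 0 < sigma by exact: lt_le_trans s1.
have sn0 : sigma != 0 by rewrite gt_eqF.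
have L0 : 0 <= L.
  by have := hL 1 0; rewrite subr0 normr1 mulr1; exact: le_trans.
have f'2 w : `|f' w| <= 2.
  by rewrite f'E; apply: le_trans (ler_normD _ _) _; rewrite lerD ?wf1// std_normal_dev1//;
    exact: lipschitz_continuous hL.
have f_lip u v : v < u -> `|f u - f v| <= 2 * (u - v).
  move=> vu; have [x _ ->] := mean_value vu df.
  have uv0 : 0 < u - v by rewrite subr_gt0.
  by rewrite normrM (gtr0_norm uv0) ler_wpM2r ?(ltW uv0)//; exact: f'2.
have f'_lip u v : v < u -> `|f' u - f' v| <= (C + 2 * `|v| + L) * (u - v).
  move=> vu; have uv0 : 0 < u - v by rewrite subr_gt0.
  have -> : f' u - f' v = (u - v) * f u + v * (f u - f v) + (h u - h v).
    by rewrite !f'E; ring.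
  apply: le_trans (ler_normD _ _) _; rewrite [leRHS]mulrDl; apply: lerD; last first.
    by rewrite -[X in _ <= _ * X](gtr0_norm uv0).
  apply: le_trans (ler_normD _ _) _; rewrite [leRHS]mulrDl; apply: lerD.
    by rewrite normrM (gtr0_norm uv0) mulrC ler_wpM2r// ltW.
  by rewrite normrM -mulrA mulrCA ler_wpM2l// f_lip.
have step v : `|p * f' (v + sigma^-1) + (1 - p) * f' v
    - sigma * (f (v + sigma^-1) - f v)| <= 2 * (C + 2 * `|v| + L) / sigma.
  have vs : v < v + sigma^-1 by rewrite ltrDl invr_gt0.
  have [x /andP[vx xs] ->] := mean_value vs df.
  rewrite (addrC v) addrK mulrCA divff// mulr1.
  have -> : p * f' (sigma^-1 + v) + (1 - p) * f' v - f' x =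
    p * (f' (sigma^-1 + v) - f' v) - (f' x - f' v) by ring.
  apply: le_trans (ler_normB _ _) _.
  have /andP[p0 p1] := p01.
  rewrite -mulrA mulr_natl mulr2n; apply: lerD.
    rewrite normrM (ger0_norm p0); apply: le_trans (ler_piMl _ p1) _ => //.
    by apply: le_trans (f'_lip _ _ _) _; rewrite addrC ?addrK.
  apply: le_trans (f'_lip _ _ vx) _; apply: ler_wpM2l.
    by have := le_trans (normr_ge0 _) (fC 0); have := normr_ge0 v; lra.
  by rewrite lerBlDl ltW.
pose w (k : nat) := (k%:R - m.+1%:R * p) / sigma.
have wS k : w k.+1 = w k + sigma^-1.
  by rewrite /w -natr1 -addrA (addrC 1) addrA mulrDl mul1r.
have -> : coin_mean p m.+1 (fun s => h (w (count_mem true s))) - c =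
    coin_mean p m (fun s => p * f' (w (count_mem true s) + sigma^-1)
      + (1 - p) * f' (w (count_mem true s))
      - sigma * (f (w (count_mem true s) + sigma^-1) - f (w (count_mem true s)))).
  have -> : coin_mean p m.+1 (fun s => h (w (count_mem true s))) - c =
      coin_mean p m.+1 (fun s => f' (w (count_mem true s))
        - sigma^-1 * (((count_mem true s)%:R - m.+1%:R * p)
                      * f (w (count_mem true s)))).
    rewrite -[in LHS](coin_mean_cst p m.+1 c) -coin_meanB.
    by apply: eq_coin_mean => s _; rewrite f'E {2}/w mulrA (mulrC sigma^-1); ring.
  rewrite !coin_meanB coin_meanD !coin_meanZ.
  rewrite (coin_mean_centered p true m (f \o w)) (coin_mean_countS p true m (f' \o w)).
  rewrite coin_meanB /=; congr (_ * _ + _ - _).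
    by apply: eq_coin_mean => s _; rewrite wS.
  rewrite -s2 expr2 mulrA mulKf//. rewrite -coin_meanB; congr (_ * _).
  by apply: eq_coin_mean => s _; rewrite wS.
apply: le_trans (norm_coin_mean p01 _ _) _.
apply: (@le_trans _ _ (coin_mean p m (fun s =>
    2 * (C + L + 2) / sigma + 4 / sigma * w (count_mem true s) ^+ 2))).
  apply: coin_mean_le => // s _; apply: le_trans (step _) _.
  set v := w _.
  rewrite [leRHS](_ : _ = (2 * (C + L + 2) + 4 * v ^+ 2) / sigma); last first.
    by field.
  rewrite ler_pM2r ?invr_gt0//.
  have : `|v| <= 1 + v ^+ 2.
    by rewrite -(real_normK (num_real v)); have := sqr_ge0 (`|v| - 2^-1); nra.
  lra.
rewrite coin_meanD coin_mean_cst coin_meanZ.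
have : coin_mean p m (fun s => w (count_mem true s) ^+ 2) <= 2.
  have -> : coin_mean p m (fun s => w (count_mem true s) ^+ 2) =
      (m%:R * p * (1 - p) + p ^+ 2) / sigma ^+ 2.
    rewrite -(coin_var_count p true) -(coin_mean_cst p m (p ^+ 2)).
    rewrite [RHS]mulrC -coin_meanD -coin_meanZ.
    have EN0 : coin_mean p m (fun s => N s - m%:R * p) = 0.
      by rewrite coin_meanB (coin_mean_count p true) coin_mean_cst subrr.
    rewrite -[RHS]addr0 -(mulr0 (- 2 * p / sigma ^+ 2)) -EN0 -coin_meanZ -coin_meanD.
    by apply: eq_coin_mean => s _; rewrite /w -[m.+1%:R]natr1 /=; field.
  rewrite ler_pdivrMr ?exprn_gt0//.
  have /andP[p0 p1] := p01.
  have : m%:R * p * (1 - p) <= sigma ^+ 2.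
    by rewrite s2 -natr1 !mulrDl mul1r lerDl mulr_ge0 ?subr_ge0.
  have : p ^+ 2 <= 1 by rewrite expr_le1.
  have : 1 <= sigma ^+ 2 by rewrite expr_ge1// ltW.
  lra.
move=> w2; rewrite -[leRHS]mulrA mulrA.
rewrite [leRHS](_ : _ = 2 * (C + L + 2) / sigma + 4 / sigma * 2); last by field.
by rewrite lerD2l ler_wpM2l// divr_ge0// ltW.
Qed.

Lemma coin_mean_norm_le p m (g : seq bool -> R) : 0 <= p <= 1 ->
  coin_mean p m (fun s => `|g s|) <= Num.sqrt (coin_mean p m (fun s => g s ^+ 2)).
Proof.
move=> p01; set a := coin_mean p m _.
have a0 : 0 <= a by apply: coin_mean_ge0.
rewrite -(ger0_norm a0) -sqrtr_sqr ler_wsqrtr//.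
have : 0 <= coin_mean p m (fun s => (`|g s| - a) ^+ 2).
  by apply: coin_mean_ge0 => // s _; exact: sqr_ge0.
have -> : coin_mean p m (fun s => (`|g s| - a) ^+ 2) =
    coin_mean p m (fun s => g s ^+ 2 + (- 2 * a * `|g s| + a ^+ 2)).
  by apply: eq_coin_mean => s _; rewrite sqrrB real_normK ?num_real//; ring.
rewrite !coin_meanD coin_meanZ coin_mean_cst -/a => h.
rewrite -subr_ge0; apply: le_trans h _; rewrite le_eqVlt; apply/orP; left.
by apply/eqP; ring.
Qed.

(** With [u], [v], [x] the second moments of [U], [V] and [U + V], expanding the
    square gives exactly [(v - (sqrt u - sqrt x) ^ 2) / sqrt (u x)]; and [x] is
    at least [u / 4] when [V] is small. *)
Lemma coin_mean_normalized_perturbation p m (U V : seq bool -> R) :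
  0 <= p <= 1 -> 0 < coin_mean p m (fun s => U s ^+ 2) ->
  4 * coin_mean p m (fun s => V s ^+ 2) <= coin_mean p m (fun s => U s ^+ 2) ->
  coin_mean p m (fun s =>
    ((U s + V s) / Num.sqrt (coin_mean p m (fun s => (U s + V s) ^+ 2)) -
      U s / Num.sqrt (coin_mean p m (fun s => U s ^+ 2))) ^+ 2) <=
  2 * coin_mean p m (fun s => V s ^+ 2) / coin_mean p m (fun s => U s ^+ 2).
Proof.
move=> p01.
set u := coin_mean p m (fun s => U s ^+ 2).
set v := coin_mean p m (fun s => V s ^+ 2).
set x := coin_mean p m (fun s => (U s + V s) ^+ 2).
move=> u0 vu.
have x_ge : u / 4 <= x.
  have : u / 2 - v <= x; last by lra.
  rewrite /u /v mulrC -coin_meanZ -coin_meanB.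
  apply: coin_mean_le => // s _.
  by have := sqr_ge0 (U s + 2 * V s); nra.
have x0 : 0 < x by apply: lt_le_trans x_ge; rewrite divr_gt0.
have su0 : 0 < Num.sqrt u by rewrite sqrtr_gt0.
have sx0 : 0 < Num.sqrt x by rewrite sqrtr_gt0.
have uE : u = Num.sqrt u ^+ 2 by rewrite sqr_sqrtr// ltW.
have xE : x = Num.sqrt x ^+ 2 by rewrite sqr_sqrtr// ltW.
set su := Num.sqrt u in su0 uE *; set sx := Num.sqrt x in sx0 xE *.
have su_neq0 : su != 0 by rewrite gt_eqF.
have sx_neq0 : sx != 0 by rewrite gt_eqF.
have -> : coin_mean p m (fun s => ((U s + V s) / sx - U s / su) ^+ 2) =
    (v - (su - sx) ^+ 2) / (su * sx).
  have -> : (v - (su - sx) ^+ 2) / (su * sx) =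
      (sx ^- 2 - (su * sx)^-1) * x + ((su ^- 2 - (su * sx)^-1) * u + (su * sx)^-1 * v).
    by rewrite uE xE; field; rewrite su_neq0 sx_neq0.
  rewrite /x /u /v -!coin_meanZ -!coin_meanD.
  by apply: eq_coin_mean => s _; field; rewrite su_neq0 sx_neq0.
have su_le : su <= 2 * sx.
  rewrite -(@ler_pXn2r _ 2)// ?nnegrE ?mulr_ge0 ?(ltW su0) ?(ltW sx0)//.
  by rewrite exprMn -uE -xE; lra.
have v0 : 0 <= v by apply: coin_mean_ge0 => // s _; exact: sqr_ge0.
rewrite ler_pdivrMr ?mulr_gt0//.
apply: (@le_trans _ _ v); first by rewrite gerBl sqr_ge0.
rewrite uE [leRHS](_ : _ = v * (2 * sx / su)); last by field.
by rewrite ler_peMr// ler_pdivlMr// mul1r.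
Qed.

(** The score with [m.+2] cards, as a function of the [m.+1] coins that matter. *)
Definition winning_guesses m (s : seq bool) : R := m.+2%:R - (zero_runs s)%:R.

Lemma winning_guessesE m s : size s = m.+1 ->
  winning_guesses m s = 1 + N s + A s.
Proof.
move=> sm; rewrite /winning_guesses.
have : (m.+2 = 1 + count_mem true s + adjacent_zeros s
    + zero_runs s)%N.
  have := count_predC (pred1 true) s.
  rewrite (@eq_count _ (predC (pred1 true)) (pred1 false)); last by case.
  rewrite sm.
  by have := zero_runsD s; lia.
move=> /(congr1 (fun k => k%:R : R)); rewrite !natrD; lra.
Qed.

Lemma coin_mean_winning_guesses p m :
  coin_mean p m.+1 (winning_guesses m) = 1 + m.+1%:R * p + m%:R * (1 - p) ^+ 2.
Proof.
rewrite (eq_coin_mean p (@winning_guessesE m)) !coin_meanD coin_mean_cst.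
by rewrite (coin_mean_count p true) coin_mean_adjacent_zeros.
Qed.

(** The first error term is that of the number of ones.  The second one is the
    cost of replacing the score by the number of ones: for [q <= 1 / 24] the
    ratio of the two variances is at most [6 q], hence a mean square distance of
    at most [12 q], rounded up to [16 q] for its square root. *)
Theorem winning_guesses_clt_bound (h : R -> R) (L : R) :
  (forall x, 0 <= h x <= 1) ->
  (forall x y, `|h x - h y| <= L * `|x - y|) ->
  exists K, forall p m, 0 < 1 - p -> 24 * (1 - p) <= 1 ->
    let sigma := Num.sqrt (m.+1%:R * p * (1 - p)) in
    let X := winning_guesses m in
    let mu := coin_mean p m.+1 X in
    1 <= sigma ->
    `|coin_mean p m.+1 (fun s => h ((X s - mu) /
         Num.sqrt (coin_mean p m.+1 (fun s => (X s - mu) ^+ 2))))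
      - std_normal_mean h| <= K / sigma + K * Num.sqrt (1 - p).
Proof.
move=> h01 hL; have [K0 clt] := binomial_clt_bound h01 hL.
have L0 : 0 <= L.
  by have := hL 1 0; rewrite subr0 normr1 mulr1; exact: le_trans.
exists (`|K0| + 4 * L) => p m; set q := 1 - p => q0 q24 sigma X mu s1.
have p01 : 0 <= p <= 1 by apply/andP; split; rewrite /q in q0 q24; lra.
have s0 : 0 < sigma by exact: lt_le_trans s1.
have s2 : sigma ^+ 2 = m.+1%:R * p * (1 - p).
  by rewrite sqr_sqrtr// mulr_ge0 ?mulr_ge0 ?(ltW q0)//; case/andP: p01.
pose U s : R := N s - m.+1%:R * p.
pose V s : R := A s - m%:R * q ^+ 2.
have XUV s : size s = m.+1 -> X s - mu = U s + V s.
  move=> sm; rewrite /X /mu winning_guessesE// coin_mean_winning_guesses /U /V -/q.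
  by ring.
have EU2 : coin_mean p m.+1 (fun s => U s ^+ 2) = sigma ^+ 2.
  by rewrite s2 (coin_var_count p true).
have EV2 := coin_var_adjacent_zeros p01 m.
have EV2' : coin_mean p m.+1 (fun s => V s ^+ 2) <= 6 * q * sigma ^+ 2.
  apply: le_trans EV2 _; rewrite s2 -/q -natr1.
  have p2 : 0 <= p - 2^-1 by rewrite /q in q24; lra.
  have mq : 0 <= m%:R * q ^+ 2 by rewrite mulr_ge0 ?exprn_ge0 ?(ltW q0).
  have pq : 0 <= p * q ^+ 2.
    by rewrite mulr_ge0 ?exprn_ge0 ?(ltW q0)//; case/andP: p01.
  rewrite [leRHS](_ : _ = 6 * (p * (m%:R * q ^+ 2)) + 6 * (p * q ^+ 2)); last by ring.
  by have := mulr_ge0 p2 mq; lra.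
set x := coin_mean p m.+1 (fun s => (X s - mu) ^+ 2).
have xE : x = coin_mean p m.+1 (fun s => (U s + V s) ^+ 2).
  by apply: eq_coin_mean => s sm; rewrite XUV.
have Udist := @coin_mean_normalized_perturbation p m.+1 U V p01.
rewrite EU2 -xE in Udist.
have {}Udist := Udist (exprn_gt0 _ s0).
have dist : coin_mean p m.+1 (fun s => ((U s + V s) / Num.sqrt x - U s / sigma) ^+ 2)
    <= 12 * q.
  rewrite -(gtr0_norm s0) -sqrtr_sqr; apply: le_trans (Udist _) _.
    apply: le_trans (ler_wpM2l _ EV2') _ => //.
    rewrite [leLHS](_ : _ = 24 * q * sigma ^+ 2); last by ring.
    by rewrite ler_piMl ?exprn_ge0 ?(ltW s0).
  rewrite ler_pdivrMr ?exprn_gt0//; lra.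
have -> : coin_mean p m.+1 (fun s => h ((X s - mu) / Num.sqrt x)) =
    coin_mean p m.+1 (fun s => h (U s / sigma)) +
    coin_mean p m.+1 (fun s => h ((U s + V s) / Num.sqrt x) - h (U s / sigma)).
  rewrite -coin_meanD; apply: eq_coin_mean => s sm; rewrite XUV//; ring.
rewrite addrAC; apply: le_trans (ler_normD _ _) _.
have := clt p m sigma p01 s1 s2; rewrite -/U => clt'.
apply: lerD.
  apply: le_trans clt' _; rewrite ler_pM2r ?invr_gt0//.
  by apply: le_trans (ler_norm _) _; rewrite lerDl mulr_ge0.
apply: le_trans (norm_coin_mean p01 _ _) _.
apply: (@le_trans _ _ (coin_mean p m.+1 (fun s =>
    L * `|(U s + V s) / Num.sqrt x - U s / sigma|))).
  by apply: coin_mean_le.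
rewrite coin_meanZ.
apply: (@le_trans _ _ (L * Num.sqrt (16 * q))).
  apply: ler_wpM2l => //; apply: le_trans (coin_mean_norm_le _ _ p01) _.
  by apply: ler_wsqrtr; apply: le_trans dist _; rewrite ler_wpM2r ?(ltW q0)// ler_nat.
rewrite sqrtrM// (_ : Num.sqrt 16 = 4); last first.
  by rewrite (_ : 16 = 4 ^+ 2); [rewrite sqrtr_sqr ger0_norm|rewrite -natrX].
by rewrite mulrA (mulrC L) ler_wpM2r ?sqrtr_ge0// lerDr.
Qed.

End clt.

(** * From Lipschitz test functions to distribution functions *)

Section ramp.
Context {R : realType}.
Local Notation mu := (@lebesgue_measure R).
Local Notation phi := (@std_normal_pdf R).
Implicit Types a b x : R.

Definition ramp a b x : R := Num.min 1 (Num.max 0 ((b - x) / (b - a))).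

Lemma ramp01 a b x : 0 <= ramp a b x <= 1.
Proof. by rewrite /ramp le_min ler01 le_max lexx /= ge_min lexx. Qed.

Lemma ramp_lipschitz a b x y : a < b ->
  `|ramp a b x - ramp a b y| <= (b - a)^-1 * `|x - y|.
Proof.
move=> ab; have ab0 : 0 < (b - a)^-1 by rewrite invr_gt0 subr_gt0.
have clip_le (s t : R) : s <= t ->
    `|Num.min 1 (Num.max 0 s) - Num.min 1 (Num.max 0 t)| <= t - s.
  move=> st; rewrite distrC ger0_norm; last by rewrite subr_ge0 le_min2// le_max2.
  by rewrite /Order.min /Order.max; do ![case: ifPn => //]; rewrite -?leNgt; lra.
have clip (s t : R) : `|Num.min 1 (Num.max 0 s) - Num.min 1 (Num.max 0 t)| <= `|t - s|.
  have [st|/ltW st] := leP s t; first exact: le_trans (clip_le _ _ st) (ler_norm _).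
  by rewrite distrC (le_trans (clip_le _ _ st))// distrC ler_norm.
apply: le_trans (clip _ _) _.
rewrite -mulrBl normrM (gtr0_norm ab0) mulrC (_ : b - y - (b - x) = x - y)//.
by ring.
Qed.

Lemma ramp_ge a b x : a < b -> (x <= a)%R%:R <= ramp a b x.
Proof.
move=> ab; have [xa|_] := leP x a; last by case/andP: (ramp01 a b x).
rewrite /ramp le_min lexx /= le_max; apply/orP; right.
by rewrite ler_pdivlMr ?subr_gt0// mul1r lerD2l lerN2.
Qed.

Lemma ramp_le a b x : a < b -> ramp a b x <= (x <= b)%R%:R.
Proof.
move=> ab; have [_|bx] := leP x b; first by case/andP: (ramp01 a b x).
rewrite /ramp ge_min ge_max lexx /=; apply/orP; right.
by rewrite pmulr_lle0 ?invr_gt0 ?subr_gt0// subr_le0 ltW.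
Qed.

Lemma std_normal_cdfE x :
  cdf (std_normal_RV R) x = (\int[mu]_y ((y <= x)%R%:R * phi y))%:E.
Proof.
have int_phi : mu.-integrable setT (EFin \o phi) by exact: integrable_normal_pdf.
rewrite /cdf /distribution /pushforward /=.
rewrite (_ : _ @^-1` _ = `]-oo, x]%classic)//.
rewrite /std_normal_law /= /normal_prob.
rewrite -[LHS]fineK; last first.
  by apply: integrable_fin_num => //; exact: integrableS int_phi.
congr EFin; rewrite -/(Rintegral _ _ _) Rintegral_mkcond.
apply: eq_Rintegral => y _; rewrite patchE mem_setE in_itv /=.
by case: ifP; rewrite ?mul1r ?mul0r.
Qed.

Lemma integrable_le_phi (g : R -> R) : measurable_fun setT g ->
  (forall x, 0 <= g x <= 1) ->
  mu.-integrable setT (EFin \o (fun x => g x * phi x)).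
Proof.
move=> mg g01.
have int_phi : mu.-integrable setT (EFin \o phi) by exact: integrable_normal_pdf.
apply: le_integrable int_phi => //.
  apply/measurable_EFinP; apply: measurable_funM => //.
  exact: measurable_normal_pdf.
move=> x _ /=; case/andP: (g01 x) => g0 g1.
by rewrite lee_fin normrM (ger0_norm g0) ler_piMl.
Qed.

Lemma measurable_ramp a b : a < b -> measurable_fun setT (ramp a b).
Proof.
move=> ab; apply: continuous_measurable_fun.
by apply: lipschitz_continuous => x y; exact: ramp_lipschitz.
Qed.

Lemma measurable_le_indic x : measurable_fun setT (fun y : R => (y <= x)%R%:R : R).
Proof.
rewrite (_ : (fun _ => _) = \1_`]-oo, x]%classic); first exact: measurable_indic.
by apply/funext => y; rewrite indicE mem_setE in_itv.
Qed.

Lemma std_normal_cdf_le_ramp a b : a < b ->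
  fine (cdf (std_normal_RV R) a) <= std_normal_mean (ramp a b).
Proof.
move=> ab; rewrite std_normal_cdfE /std_normal_mean.
apply: le_Rintegral => //.
- apply: integrable_le_phi; first exact: measurable_le_indic.
  by move=> x; rewrite ler0n lern1 leq_b1.
- by apply: integrable_le_phi; [exact: measurable_ramp|exact: ramp01].
- by move=> x _; rewrite ler_wpM2r ?ramp_ge// ltW ?std_normal_pdf_gt0.
Qed.

Lemma ramp_le_std_normal_cdf a b : a < b ->
  std_normal_mean (ramp a b) <= fine (cdf (std_normal_RV R) b).
Proof.
move=> ab; rewrite std_normal_cdfE /std_normal_mean.
apply: le_Rintegral => //.
- by apply: integrable_le_phi; [exact: measurable_ramp|exact: ramp01].
- apply: integrable_le_phi; first exact: measurable_le_indic.
  by move=> x; rewrite ler0n lern1 leq_b1.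
- by move=> x _; rewrite ler_wpM2r ?ramp_le// ltW ?std_normal_pdf_gt0.
Qed.

(** Ramps starting or ending at [x] sandwich the indicator of the half-line, and
    the continuity of the limit at [x] absorbs the width of the ramps. *)
Theorem cvg_cdf_std_normal (p : nat -> R) (m : nat -> nat)
    (Y : nat -> seq bool -> R) (x : R) :
  (\forall n \near \oo, 0 <= p n <= 1) ->
  (forall a b, a < b -> coin_mean (p n) (m n) (fun s => ramp a b (Y n s))
     @[n --> \oo] --> std_normal_mean (ramp a b)) ->
  {for x, continuous (cdf (std_normal_RV R))} ->
  (coin_mean (p n) (m n) (fun s => (Y n s <= x)%R%:R))%:E
    @[n --> \oo] --> cdf (std_normal_RV R) x.
Proof.
move=> p01 cY cont.
pose F y := fine (cdf (std_normal_RV R) y).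
have FE y : cdf (std_normal_RV R) y = (F y)%:E by rewrite /F std_normal_cdfE.
have contF : F y @[y --> x] --> F x by apply: fine_cvg; rewrite -FE; exact: cont.
suff c : coin_mean (p n) (m n) (fun s => (Y n s <= x)%R%:R) @[n --> \oo] --> F x.
  by rewrite FE; apply: cvg_EFin; [exact: nearW|exact: c].
apply/cvgrPdist_le => e e0.
have e2 : 0 < e / 2 by rewrite divr_gt0.
have [dl /= dl0 Fdl] : exists2 dl : R, 0 < dl &
    forall y, `|x - y| <= dl -> `|F x - F y| <= e / 2.
  move/cvgrPdist_le/(_ _ e2): contF => [/= r r0 Fr].
  exists (r / 2); first by rewrite divr_gt0.
  by move=> y xy; apply: Fr; rewrite /= (le_lt_trans xy)// ltr_pdivrMr// mulr_natr mulr2n ltrDl.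
have up : x < x + dl by rewrite ltrDl.
have down : x - dl < x by rewrite gtrBl.
have Fup : F (x + dl) <= F x + e / 2.
  have := Fdl (x + dl); rewrite opprD addNKr normrN gtr0_norm// lexx => /(_ isT).
  by rewrite ler_norml => /andP[]; lra.
have Fdown : F x - e / 2 <= F (x - dl).
  have := Fdl (x - dl); rewrite opprB addrC subrK gtr0_norm// lexx => /(_ isT).
  by rewrite ler_norml => /andP[]; lra.
near=> n.
have pn : 0 <= p n <= 1 by near: n.
have : `|std_normal_mean (ramp x (x + dl)) -
    coin_mean (p n) (m n) (fun s => ramp x (x + dl) (Y n s))| <= e / 2.
  by near: n; move/cvgrPdist_le: (cY _ _ up); apply.
have : `|std_normal_mean (ramp (x - dl) x) -
    coin_mean (p n) (m n) (fun s => ramp (x - dl) x (Y n s))| <= e / 2.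
  by near: n; move/cvgrPdist_le: (cY _ _ down); apply.
have : coin_mean (p n) (m n) (fun s => (Y n s <= x)%R%:R) <=
    coin_mean (p n) (m n) (fun s => ramp x (x + dl) (Y n s)).
  by apply: coin_mean_le => // s _; exact: ramp_ge.
have : coin_mean (p n) (m n) (fun s => ramp (x - dl) x (Y n s)) <=
    coin_mean (p n) (m n) (fun s => (Y n s <= x)%R%:R).
  by apply: coin_mean_le => // s _; exact: ramp_le.
have : std_normal_mean (ramp x (x + dl)) <= F (x + dl).
  exact: ramp_le_std_normal_cdf.
have : F (x - dl) <= std_normal_mean (ramp (x - dl) x).
  exact: std_normal_cdf_le_ramp.
rewrite !ler_norml => ? ? ? ? /andP[? ?] /andP[? ?].
by apply/andP; split; lra.
Unshelve. all: by end_near. Qed.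

End ramp.

(** * The three regimes *)

Lemma cvg_powR_natr (R : realType) (a : R) : 0 < a ->
  (n%:R `^ a : R) @[n --> \oo] --> +oo.
Proof.
move=> a0; apply/cvgryPge => B; near=> n.
have [B0|B0] := leP B 0; first exact: le_trans B0 (powR_ge0 _ _).
rewrite (_ : B = (B `^ a^-1) `^ a); last first.
  by rewrite -powRrM mulVf ?lt0r_neq0// powRr1// ltW.
rewrite ge0_ler_powR ?nnegrE ?powR_ge0 ?(ltW a0)//.
by near: n; exact: nbhs_infty_ger.
Unshelve. all: by end_near. Qed.

Section game.
Context d (T : measurableType d) (R : realType) (P : probability T R).
Variables (m : nat) (p : R) (eps : nat -> {RV P >-> bool}).
Hypotheses (p_ge : 2^-1 <= p) (p_le1 : p <= 1).
Hypothesis coins_eps : shuffle_coins m.+2 p eps.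
Local Notation X := (num_correct m.+2 p eps).
Local Notation W := (@winning_guesses R m).
Local Notation E := (coin_mean p m.+1).

Let p01 : 0 <= p <= 1.
Proof. by rewrite p_le1 andbT (le_trans _ p_ge). Qed.

Lemma num_correctE : X = W \o coin_seq m.+2 eps.
Proof.
apply/funext => w; rewrite /num_correct /winning_guesses /=.
have := @correct_guesses_zero_runs R p m.+2 p_ge (fun j => eps j w) isT.
move=> /(congr1 (fun k => k%:R : R)) <-; rewrite natrD addrK//.
Qed.

Lemma probability_num_correct (B : pred R) :
  P [set w | B (X w)] = (E (fun s => (B (W s))%:R))%:E.
Proof. by rewrite num_correctE (probability_coin_pred p01 coins_eps (B \o W)). Qed.

Lemma expectation_num_correct : ('E_P[X])%E = (E W)%:E.
Proof. by rewrite num_correctE (expectation_coin_seq p01 coins_eps). Qed.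

Lemma variance_num_correct :
  ('V_P[X])%E = (E (fun s => (W s - E W) ^+ 2))%:E.
Proof. by rewrite num_correctE (variance_coin_seq p01 coins_eps). Qed.

End game.

Section limits.
Variables (R : realType) (alpha lambda : R) (p : nat -> R).
Variables (d : nat -> measure_display) (T : forall n, measurableType (d n)).
Variables (P : forall n, probability (T n) R).
Variable eps : forall n, nat -> {RV (P n) >-> bool}.
Hypotheses (alpha_gt0 : 0 < alpha) (lambda_gt0 : 0 < lambda).
Hypothesis p_def : \forall n \near \oo, p n = 1 - lambda / n%:R `^ alpha.
Hypothesis eps_coins : \forall n \near \oo, shuffle_coins n (p n) (@eps n).

Local Notation X n := (num_correct n (p n) (@eps n)).
Let q n : R := lambda / n%:R `^ alpha.

Let q_ge0 n : 0 <= q n.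
Proof. by rewrite divr_ge0 ?powR_ge0 ?ltW. Qed.

Let q_cvg0 : q n @[n --> \oo] --> 0.
Proof.
rewrite -(mulr0 lambda); apply: cvgMl_tmp.
apply/gtr0_cvgV0; last exact: cvg_powR_natr.
by near=> n; rewrite powR_gt0// ltr0n; near: n; exact: nbhs_infty_gt.
Unshelve. all: by end_near. Qed.

(** What the three limits need to know of the parameters for large [n].  The
    substitution [n = m.+2] makes the [m.+1] relevant coins apparent. *)
Let regime (e : R) : 0 < e ->
  \forall n \near \oo, exists m : nat,
    [/\ n = m.+2, p n = 1 - q n, 0 < q n, q n <= e &
        shuffle_coins n (p n) (@eps n)].
Proof.
move=> e0; near=> n.
have n2 : (1 < n)%N by near: n; exact: nbhs_infty_gt.
exists n.-2; split.
- by case: (n) n2 => [|[|k]].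
- by near: n.
- by rewrite divr_gt0// powR_gt0// ltr0n ltnW.
- by near: n; move/cvgrPdist_le: q_cvg0 => /(_ _ e0); apply: filterS => n;
    rewrite sub0r normrN; apply: le_trans; exact: ler_norm.
- by near: n.
Unshelve. all: by end_near. Qed.

Lemma proportion_cvg :
  cvg_in_probability P (fun n => n%:R^-1 \o* (X n : {RV (P n) >-> R})) 1.
Proof.
move=> e e0.
have bound : (q n / e)%:E @[n --> \oo] --> 0%E.
  apply: cvg_EFin; first exact: nearW.
  by rewrite -(mul0r e^-1); apply: cvgMr_tmp; exact: q_cvg0.
apply: squeeze_cvge (cvg_cst 0%E) bound.
have := @regime 2^-1; rewrite invr_gt0 ltr0n => /(_ isT); apply: filterS => n.
case=> m [nE pE q0 q2 coins]; subst n; rewrite measure_ge0 /=.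
have p_ge : 2^-1 <= p m.+2 by rewrite pE; lra.
have p_le1 : p m.+2 <= 1 by rewrite pE; lra.
have p01 : 0 <= p m.+2 <= 1 by rewrite p_le1 andbT; lra.
have n0 : 0 < m.+2%:R :> R by rewrite ltr0n.
rewrite (probability_num_correct p_ge p_le1 coins
  (fun x => e < `|x * m.+2%:R^-1 - 1|)) lee_fin.
apply: (@le_trans _ _ ((m.+2%:R * e)^-1 *
    coin_mean (p m.+2) m.+1 (fun s => (zero_runs s)%:R))).
  rewrite -coin_meanZ; apply: coin_mean_le => // s _.
  rewrite /winning_guesses mulrBl divff ?gt_eqF// addrC addKr normrN.
  rewrite ger0_norm ?divr_ge0//; case: ltP => [|_]; last first.
    by rewrite mulr_ge0// invr_ge0 mulr_ge0 ?(ltW e0).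
  rewrite ltr_pdivlMr// mulrC => lt_runs.
  by rewrite mulrC ler_pdivlMr ?mulr_gt0// mul1r ltW.
apply: (@le_trans _ _ ((m.+2%:R * e)^-1 * (m.+2%:R * q m.+2))).
  rewrite ler_wpM2l ?invr_ge0 ?mulr_ge0 ?(ltW e0)//.
  apply: le_trans (coin_mean_zero_runs_le _ p01) _.
  by rewrite pE subKr ler_wpM2r ?(ltW q0)// ler_nat.
by rewrite le_eqVlt; apply/orP; left; apply/eqP; field; rewrite !gt_eqF.
Qed.

(** With [alpha = 1], [n.-1 * q] equals [lambda - q]. *)
Lemma poisson_cvg : alpha = 1 ->
  cvg_in_distribution P (fun n => cst n%:R \- (X n : {RV (P n) >-> R}))
    (poisson_RV lambda).
Proof.
move=> a1 x _.
have mq : n.-1%:R * q n @[n --> \oo] --> lambda.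
  have : lambda - q n @[n --> \oo] --> lambda.
    by rewrite -[L in _ --> L]subr0; apply: cvgB; [exact: cvg_cst|exact: q_cvg0].
  apply: cvg_trans; apply: near_eq_cvg; near=> n.
  have n0 : (0 < n)%N by near: n; exact: nbhs_infty_gt.
  have nR0 : n%:R != 0 :> R by rewrite pnatr_eq0 -lt0n.
  have nE : n%:R = n.-1%:R + 1 :> R by rewrite natr1 prednK.
  by rewrite /q a1 powRr1// nE; field; rewrite -nE.
have q0 : \forall n \near \oo, 0 <= q n by exact: nearW.
have lim := @cvg_zero_runs_poisson R lambda q predn x lambda_gt0 q0 q_cvg0 mq.
apply: cvg_trans lim; apply: near_eq_cvg.
have := @regime 2^-1; rewrite invr_gt0 ltr0n => /(_ isT); apply: filterS => n.
case=> m [nE pE q_gt0 q2 coins]; subst n.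
have p_ge : 2^-1 <= p m.+2 by rewrite pE; lra.
have p_le1 : p m.+2 <= 1 by rewrite pE; lra.
rewrite /cdf /distribution /pushforward.
transitivity (P m.+2 [set w | m.+2%:R - X m.+2 w <= x]); last first.
  by congr (P m.+2 _); apply/seteqP; split => w /=; rewrite in_itv.
rewrite (probability_num_correct p_ge p_le1 coins (fun y => m.+2%:R - y <= x)).
congr EFin; rewrite pE; apply: eq_coin_mean => s _.
by rewrite /winning_guesses opprB addrC subrK.
Unshelve. all: by end_near. Qed.

Lemma normal_cvg : alpha < 1 ->
  cvg_in_distribution P
    (fun n => (Num.sqrt (fine ('V_(P n)[X n])%E))^-1 \o*
              ((X n : {RV (P n) >-> R}) \- cst (fine ('E_(P n)[X n])%E)))
    (std_normal_RV R).
Proof.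
move=> a1 x cont.
pose M n := coin_mean (1 - q n) n.-1.
pose W n := @winning_guesses R n.-2.
pose V n := M n (fun s => (W n s - M n (W n)) ^+ 2).
pose Y n s := (W n s - M n (W n)) / Num.sqrt (V n).
pose sigma n := Num.sqrt (n.-1%:R * (1 - q n) * q n).
(* As [q <= 1/2] and [n.-1 >= n / 2], the variance is at least
   [n q / 4 = lambda / 4 * n `^ (1 - alpha)]. *)
have sigma_y : sigma n @[n --> \oo] --> +oo.
  have c_gt0 : 0 < lambda / 4 by rewrite divr_gt0.
  have ry := @cvg_powR_natr R (1 - alpha); rewrite subr_gt0 in ry.
  apply/cvgryPge => B; near=> n.
  apply: (@le_trans _ _ (Num.sqrt (B ^+ 2))); first by rewrite sqrtr_sqr ler_norm.
  apply: ler_wsqrtr.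
  have n2 : (1 < n)%N by near: n; exact: nbhs_infty_gt.
  have n0 : 0 < n%:R :> R by rewrite ltr0n ltnW.
  have q2 : q n <= 2^-1.
    near: n; have := @regime 2^-1; rewrite invr_gt0 ltr0n => /(_ isT).
    by apply: filterS => n [m []].
  apply: (@le_trans _ _ (lambda / 4 * n%:R `^ (1 - alpha))).
    rewrite mulrC -ler_pdivrMr//.
    by near: n; move/cvgryPge: (ry a1); apply.
  rewrite powRB ?gt_eqF ?implybT// powRr1 ?(ltW n0)//.
  rewrite (_ : lambda / 4 * _ = n%:R / 2 * 2^-1 * q n); last first.
    by rewrite /q; field; rewrite gt_eqF ?powR_gt0.
  rewrite ler_wpM2r ?q_ge0// ler_pM ?divr_ge0//; last by lra.
  rewrite ler_pdivrMr// -natrM ler_nat; lia.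
have p01 : \forall n \near \oo, 0 <= 1 - q n <= 1.
  have := @regime 1 ltr01; apply: filterS => n [m [_ _ q0 q1 _]].
  by apply/andP; split; lra.
have cY (a b : R) : a < b ->
    M n (fun s => ramp a b (Y n s)) @[n --> \oo] --> std_normal_mean (ramp a b).
  move=> ab; have [K bound] :=
    winning_guesses_clt_bound (ramp01 a b) (fun x y => ramp_lipschitz x y ab).
  have bound0 : K / sigma n + K * Num.sqrt (q n) @[n --> \oo] --> 0.
    have sigmaV : (sigma n)^-1 @[n --> \oo] --> 0.
      apply/gtr0_cvgV0 => //.
      by move/cvgryPge: sigma_y => /(_ 1); apply: filterS => n; exact: lt_le_trans.
    have sqrt_q : Num.sqrt (q n) @[n --> \oo] --> 0.
      by rewrite -sqrtr0; apply: continuous_cvg; [exact: sqrt_continuous|exact: q_cvg0].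
    have := cvgD (cvgM (cvg_cst K) sigmaV) (cvgM (cvg_cst K) sqrt_q).
    by rewrite !mulr0 addr0; apply.
  apply/cvgrPdist_le => e e0; near=> n.
  rewrite distrC; apply: (@le_trans _ _ (K / sigma n + K * Num.sqrt (q n))).
    have s1 : 1 <= sigma n by near: n; move/cvgryPge: sigma_y; apply.
    have : exists m : nat, [/\ n = m.+2, p n = 1 - q n, 0 < q n, q n <= 24^-1 &
        shuffle_coins n (p n) (@eps n)].
      by near: n; apply: regime; rewrite invr_gt0 ltr0n.
    move=> [m [nE _ q0 q24 _]].
    rewrite nE in q0 q24 s1 *.
    have := bound (1 - q m.+2) m; rewrite subKr => /(_ q0) bd.
    apply: bd; [lra|exact: s1].
  near: n; move/cvgrPdist_le: bound0 => /(_ _ e0); apply: filterS => n /=.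
  rewrite sub0r normrN; apply: le_trans; exact: ler_norm.
have lim := cvg_cdf_std_normal p01 cY cont.
apply: cvg_trans lim; apply: near_eq_cvg.
have := @regime 2^-1; rewrite invr_gt0 ltr0n => /(_ isT); apply: filterS => n.
case=> m [nE pE q_gt0 q2 coins]; subst n.
have p_ge : 2^-1 <= p m.+2 by rewrite pE; lra.
have p_le1 : p m.+2 <= 1 by rewrite pE; lra.
rewrite /cdf /distribution /pushforward.
rewrite (expectation_num_correct p_ge p_le1 coins).
rewrite (variance_num_correct p_ge p_le1 coins).
set mu := coin_mean _ _ (winning_guesses _).
set v := coin_mean (p m.+2) _ (fun s => _).
transitivity (P m.+2 [set w | (X m.+2 w - mu) * (Num.sqrt v)^-1 <= x]); last first.
  by congr (P m.+2 _); apply/seteqP; split => w /=; rewrite in_itv.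
rewrite (probability_num_correct p_ge p_le1 coins
  (fun y => (y - mu) * (Num.sqrt v)^-1 <= x)).
by congr EFin; rewrite /v /mu pE.
Unshelve. all: by end_near. Qed.

End limits.

Theorem theorem7 (R : realType) (alpha lambda : R) (p : nat -> R)
    (d : nat -> measure_display) (T : forall n, measurableType (d n))
    (P : forall n, probability (T n) R)
    (eps : forall n, nat -> {RV (P n) >-> bool})
    (alpha_gt0 : 0 < alpha) (lambda_gt0 : 0 < lambda)
    (p_def : \forall n \near \oo, p n = 1 - lambda / n%:R `^ alpha)
    (eps_coins : \forall n \near \oo, shuffle_coins n (p n) (eps n)) :
  let X n : {RV (P n) >-> R} := num_correct n (p n) (eps n) in
  [/\ 1 < alpha -> cvg_in_probability P (fun n => n%:R^-1 \o* X n) 1,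
      alpha = 1 ->
        cvg_in_distribution P (fun n => cst n%:R \- X n) (poisson_RV lambda) &
      alpha < 1 ->
        cvg_in_distribution P
          (fun n => (Num.sqrt (fine 'V_(P n)[X n]))^-1 \o*
                    (X n \- cst (fine 'E_(P n)[X n])))
          (std_normal_RV R)].
Proof.
move=> X; split => [_|a1|a1].
- exact: (proportion_cvg alpha_gt0 lambda_gt0 p_def eps_coins).
- exact: (poisson_cvg alpha_gt0 lambda_gt0 p_def eps_coins a1).
- exact: (normal_cvg alpha_gt0 lambda_gt0 p_def eps_coins a1).
Qed.
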